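(* Let $\mathcal H$ and $E_1,E_2,\dots$ be Hilbert spaces and let $S_\ell:E_\ell\to\mathcal H$ be bounded linear operators such that, with the notation of the context, $V_m=S^{(m)}(E^{(m)})$ is closed for every $m\ge1$. Let $$\widehat G^{(m)}=L_m\mathcal D_mL_m^*,\qquad \mathcal D_m=\operatorname{diag}(D_1,\dots,D_m),\qquad L_m=C_m^*$$ be the canonical quotient factorization described in the context. Assume that there are constants $0<\delta\le\Delta<\infty$ and $M,K<\infty$ such that, for all $m$ and $\ell$, $$\delta I\preceq D_\ell\preceq\Delta I,\qquad \|L_m\|\le M,\qquad \|L_m^{-1}\|\le K,$$ where $D_\ell$ acts on $E_\ell/\ker D_\ell\cong(\ker D_\ell)^\perp$ and $I$ is the identity there. Then for every $m\ge1$ and every $[c]\in E^{(m)}/\ker S^{(m)}$, $$\frac{\delta}{K^2}\|[c]\|^2\le\|S^{(m)}[c]\|_{\mathcal H}^2\le\Delta M^2\|[c]\|^2 .$$ Moreover, the synthesis maps extend consistently to countably many levels: there is a unique bounded operator $S:E^{(\infty)}\to\mathcal H$ on the Hilbert direct sum $E^{(\infty)}=\bigoplus_{\ell\ge1}E_\ell$ that agrees with $S^{(m)}$ on $E^{(m)}$ for every $m$. On the resulting intrinsic coefficient space $E^{(\infty)}/\ker S$ the induced map is bounded below by $\sqrt\delta/K$, i.e. $\|Sc\|\ge(\sqrt\delta/K)\,\|[c]\|$ for all $c\in E^{(\infty)}$; its image is closed; and every function in the image has a unique minimum-norm intrinsic coefficient (it is synthesized by a unique class in $E^{(\infty)}/\ker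 S$, and this class has a unique representative of minimal norm).
   Context: $E^{(m)}=\bigoplus_{\ell=1}^mE_\ell$ (Hilbert direct sum, embedded in $E^{(\infty)}$ by padding with zeros), $S^{(m)}c=\sum_{\ell=1}^mS_\ell c_\ell$, $V_m=S^{(m)}(E^{(m)})$, $V_0=\{0\}$. Let $P_{\ell-1}$ be the orthogonal projection onto $V_{\ell-1}$, $R_\ell=(I-P_{\ell-1})S_\ell$, and $D_\ell=R_\ell^*R_\ell$ on $E_\ell$; $D_\ell$ also denotes the operator it induces on $E_\ell/\ker D_\ell$. Quotients carry the quotient norm $\|[c]\|=\inf_{z}\|c+z\|$ ($z$ in the relevant kernel) and are identified as Hilbert spaces with the orthogonal complement of the kernel. Write $\widehat S^{(m)}$ for the injective map induced by $S^{(m)}$ on $E^{(m)}/\ker S^{(m)}$ (also written $S^{(m)}[c]$), and $\widehat G^{(m)}=(\widehat S^{(m)})^*\widehat S^{(m)}$. Since the $V_m$ are closed, $R_\ell$ induces a bounded isomorphism $\widehat R_\ell:E_\ell/\ker D_\ell\to V_\ell\ominus V_{\ell-1}$, and there is a unique bounded isomorphism $C_m:E^{(m)}/\ker S^{(m)}\to\bigoplus_{\ell=1}^mE_\ell/\ker D_\ell$ with $\widehat S^{(m)}x=\sum_{\ell=1}^m\widehat R_\ell(C_mx)_\ell$ for all $x$. Setting $L_m=C_m^*$ one has $\widehat G^{(m)}=L_m\mathcal D_mL_m^*$. *)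

(* Defs.v *)
From HB Require Import structures.
From mathcomp Require Import all_boot all_order all_algebra.
From mathcomp Require Import complex ring lra.
From mathcomp Require Import all_classical all_reals all_analysis.

Set Implicit Arguments.
Unset Strict Implicit.
Unset Printing Implicit Defensive.

Import Order.TTheory GRing.Theory Num.Theory.
Import numFieldNormedType.Exports.

Local Open Scope classical_set_scope.
Local Open Scope ring_scope.

(* Hilbert spaces are taken over the real numbers or over the complex numbers;
   [sre], [sim], [sconj] are the real part, imaginary part and conjugation,
   [sreal] embeds the reals, and [sunit] is the imaginary unit (0 over R). *)
Variant field_kind := RealField | ComplexField.

Definition scalar_field (R : realType) (k : field_kind) : numFieldType :=
  match k with RealField => R | ComplexField => R[i] end.

Section Scalars.
Context {R : realType} {k : field_kind}.

Definition sre : scalar_field R k -> R :=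
  match k with RealField => fun z => z | ComplexField => fun z => complex.Re z end.

Definition sim : scalar_field R k -> R :=
  match k with RealField => fun=> 0 | ComplexField => fun z => complex.Im z end.

Definition sreal : R -> scalar_field R k :=
  match k with RealField => fun a => a | ComplexField => fun a => (a +i* 0)%C end.

Definition sunit : scalar_field R k :=
  match k with RealField => 0 | ComplexField => (0 +i* 1)%C end.

Definition sconj : scalar_field R k -> scalar_field R k :=
  match k with RealField => fun z => z | ComplexField => fun z => conjc z end.
End Scalars.

Section ScalarTheory.
Context {R : realType} {k : field_kind}.
Local Notation F := (scalar_field R k).
Implicit Types (z w : F) (a b : R).

Lemma sreD z w : sre (z + w) = sre z + sre w.
Proof. by case: k z w => //= -[? ?] [? ?]. Qed.
Lemma sreN z : sre (- z) = - sre z.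
Proof. by case: k z => //= -[? ?]. Qed.
Lemma simD z w : sim (z + w) = sim z + sim w.
Proof. by case: k z w => //= [? ?|[? ?] [? ?]] //=; rewrite addr0. Qed.
Lemma simN z : sim (- z) = - sim z.
Proof. by case: k z => //= [?|[? ?]] //=; rewrite oppr0. Qed.
Lemma srealD a b : sreal (a + b) = sreal a + sreal b :> F.
Proof. by case: k => //=; rewrite -[RHS]/(_ +i* _)%C addr0. Qed.
Lemma srealM a b : sreal (a * b) = sreal a * sreal b :> F.
Proof.
case: k => //=; rewrite -[RHS]/(_ +i* _)%C; congr (_ +i* _)%C.
  by rewrite mulr0 subr0.
by rewrite mulr0 mul0r addr0.
Qed.
Lemma sreal0 : sreal 0 = 0 :> F. Proof. by case: k. Qed.
Lemma sreal1 : sreal 1 = 1 :> F. Proof. by case: k. Qed.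
Lemma srealN a : sreal (- a) = - sreal a :> F.
Proof. by apply: (addrI (sreal a)); rewrite -srealD !subrr sreal0. Qed.
Lemma srealK a : sre (sreal a : F) = a. Proof. by case: k. Qed.
Lemma sreal_ge0 a : (0 <= (sreal a : F)) = (0 <= a).
Proof. by case: k => //=; rewrite lecE /= eqxx. Qed.
Lemma ler_sreal a b : ((sreal a : F) <= sreal b) = (a <= b).
Proof. by case: k => //=; rewrite lecE /= eqxx. Qed.
Lemma ltr_sreal a b : ((sreal a : F) < sreal b) = (a < b).
Proof. by case: k => //=; rewrite ltcE /= eqxx. Qed.
Lemma scalarE z : z = sreal (sre z) + sunit * sreal (sim z).
Proof.
case: k z => //= [z|[x y]]; first by rewrite mulr0 addr0.
by apply/eqP; rewrite eq_complex/=; apply/andP; split;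
   rewrite !(mul0r, mulr0, mul1r, subr0, addr0, add0r).
Qed.
Lemma sre_ge0 z : 0 <= z -> 0 <= sre z.
Proof. by case: k z => //= -[? ?]; rewrite lecE => /andP[]. Qed.
Lemma ge0_sreK z : 0 <= z -> sreal (sre z) = z.
Proof. by case: k z => //= -[? ?]; rewrite lecE /= => /andP[/eqP->]. Qed.
Lemma sre_srealM a z : sre (sreal a * z) = a * sre z.
Proof. by case: k z => //= -[? ?] /=; rewrite mul0r subr0. Qed.
Lemma ler_sre z w : z <= w -> sre z <= sre w.
Proof. by rewrite -subr_ge0 => /sre_ge0; rewrite sreD sreN subr_ge0. Qed.

Lemma sre_norm z : sre z <= sre `|z|.
Proof.
case: k z => //= [z|[x y]] /=; first exact: ler_norm.
apply: le_trans (ler_norm _) _; rewrite -sqrtr_sqr ler_wsqrtr//.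
by rewrite lerDl sqr_ge0.
Qed.
Lemma normr_sre z : `|sre z| <= sre `|z|.
Proof.
by rewrite ler_norml sre_norm andbT lerNl -sreN -normrN sre_norm.
Qed.
Lemma normr_sim z : `|sim z| <= sre `|z|.
Proof.
case: k z => //= [z|[x y]] /=; first by rewrite normr0.
by rewrite -sqrtr_sqr ler_wsqrtr// lerDr sqr_ge0.
Qed.
Lemma norm_sunit : `|sunit : F| <= 1.
Proof.
case: k => //=; first by rewrite normr0.
by rewrite lecE/= eqxx/= expr0n/= expr1n add0r sqrtr1.
Qed.

Lemma sconjD z w : sconj (z + w) = sconj z + sconj w.
Proof. by case: k z w => //= -[? ?] [? ?]; congr (_ +i* _)%C; rewrite opprD. Qed.
Lemma sconjM z w : sconj (z * w) = sconj z * sconj w.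
Proof.
case: k z w => //= -[? ?] [? ?] /=; congr (_ +i* _)%C.
  by rewrite mulrNN.
by rewrite mulrN mulNr opprD.
Qed.
Lemma sconjK : involutive (@sconj R k).
Proof. by case: k => //= -[? ?] /=; rewrite opprK. Qed.
Lemma sconj_real a : sconj (sreal a : F) = sreal a.
Proof. by case: k => //=; rewrite oppr0. Qed.
Lemma sconj0 : sconj 0 = 0 :> F.
Proof. by rewrite -sreal0 sconj_real. Qed.
Lemma sconjN z : sconj (- z) = - sconj z.
Proof. by apply: (addrI (sconj z)); rewrite -sconjD !subrr sconj0. Qed.
Lemma normr_sconj z : `|sconj z| = `|z|.
Proof. by case: k z => //= -[x y]; rewrite !normc_def/= sqrrN. Qed.
Lemma mul_sconj z : z * sconj z = `|z| ^+ 2.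
Proof.
case: k z => //= [z|z]; first by rewrite real_normK ?num_real// expr2.
by rewrite sqr_normc.
Qed.
Lemma sconj_ge0 z : 0 <= z -> sconj z = z.
Proof. by move=> /ge0_sreK <-; rewrite sconj_real. Qed.
Lemma sre_conj z : sre (sconj z) = sre z.
Proof. by case: k z => //= -[]. Qed.
Lemma add_sconj z : z + sconj z = sreal (sre z *+ 2).
Proof.
by case: k z => //= -[x y]; rewrite -[LHS]/(_ +i* _)%C subrr mulr2n.
Qed.
End ScalarTheory.


Section DotNorm.
Context {R : realType} {k : field_kind}.
Local Notation F := (scalar_field R k).
Variables (V : lmodType F) (dot : V -> V -> F).
Hypothesis dot_linearl : forall y, linear_for ( *%R ) (dot^~ y).
Hypothesis dot_conj : forall x y, dot y x = sconj (dot x y).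
Hypothesis dot_gt0 : forall x, x != 0 -> 0 < dot x x.

Lemma dotDl x z y : dot (x + z) y = dot x y + dot z y.
Proof. by have := dot_linearl y 1 x z; rewrite scale1r mul1r. Qed.
Lemma dot0l y : dot 0 y = 0.
Proof. by apply: (addrI (dot 0 y)); rewrite -dotDl !addr0. Qed.
Lemma dotZl a x y : dot (a *: x) y = a * dot x y.
Proof. by have := dot_linearl y a x 0; rewrite addr0 dot0l addr0. Qed.
Lemma dotDr x y z : dot x (y + z) = dot x y + dot x z.
Proof. by rewrite dot_conj dotDl sconjD -!dot_conj. Qed.
Lemma dotZr a x y : dot x (a *: y) = sconj a * dot x y.
Proof. by rewrite dot_conj dotZl sconjM -dot_conj. Qed.
Lemma dot_ge0 x : 0 <= dot x x.
Proof.
have [->|/dot_gt0/ltW//] := eqVneq x 0; by rewrite dot0l.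
Qed.

Definition dnorm x : F := sreal (Num.sqrt (sre (dot x x))).

Lemma dnorm_ge0 x : 0 <= dnorm x.
Proof. by rewrite sreal_ge0 sqrtr_ge0. Qed.

Lemma dnorm_sqr x : dnorm x ^+ 2 = dot x x.
Proof.
rewrite expr2 -srealM -expr2 sqr_sqrtr ?sre_ge0 ?dot_ge0//.
by rewrite ge0_sreK// dot_ge0.
Qed.

Lemma dnorm_eq0 x : dnorm x = 0 -> x = 0.
Proof.
move=> x0; apply/eqP; apply: contraT => /dot_gt0.
by rewrite -dnorm_sqr x0 expr0n/= ltxx.
Qed.

Lemma dnormZ a x : dnorm (a *: x) = `|a| * dnorm x.
Proof.
apply/eqP; rewrite -(@eqrXn2 _ 2)// ?mulr_ge0 ?dnorm_ge0//.
by rewrite exprMn !dnorm_sqr dotZl dotZr mulrA mul_sconj.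
Qed.

Lemma dot_CS x y : `|dot x y| <= dnorm x * dnorm y.
Proof.
have [->|y0] := eqVneq y 0.
  by rewrite dot_conj dot0l sconj0 normr0 mulr_ge0// dnorm_ge0.
have yy := dot_gt0 y0.
have := dot_ge0 (dot y y *: x + (- dot x y) *: y).
rewrite dotDl !dotDr !dotZl !dotZr (sconj_ge0 (ltW yy)) (dot_conj x y).
rewrite sconjN.
set a := dot x y; set b := sconj a; set p := dot x x; set q := dot y y.
have -> : q * (q * p) + q * (- b * a) + (- a * (q * b) + - a * (- b * q)) =
  q * (p * q - a * b) by ring.
rewrite pmulr_rge0// subr_ge0 /b mul_sconj /p /q -!dnorm_sqr -exprMn.
by rewrite ler_pXn2r// ?nnegrE ?mulr_ge0 ?dnorm_ge0.
Qed.

Lemma dnormD x y : dnorm (x + y) <= dnorm x + dnorm y.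
Proof.
rewrite -(@ler_pXn2r _ 2) ?nnegrE ?addr_ge0 ?dnorm_ge0//.
rewrite dnorm_sqr dotDl !dotDr (dot_conj x y) sqrrD -!dnorm_sqr.
rewrite addrA -[X in X + _]addrA add_sconj lerD2r lerD2l mulr2n srealD mulr2n.
have h : sreal (sre (dot x y)) <= dnorm x * dnorm y.
  apply: le_trans (dot_CS x y); rewrite -[leRHS]ge0_sreK// ler_sreal.
  exact: sre_norm.
exact: lerD.
Qed.

End DotNorm.

HB.mixin Record isHilbert (R : realType) (k : field_kind) V
    of CompleteNormedModule (scalar_field R k) V := {
  inner : V -> V -> scalar_field R k;
  inner_linearl : forall y, linear_for ( *%R ) (inner^~ y);
  inner_conj : forall x y, inner y x = sconj (inner x y);
  inner_norm : forall x, inner x x = `|x| ^+ 2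
}.

#[short(type="hilbertType")]
HB.structure Definition Hilbert (R : realType) (k : field_kind) :=
  {V of isHilbert R k V & CompleteNormedModule (scalar_field R k) V}.

(* Sequential forms, for a squared norm q, of the Cauchy and convergence
   conditions. *)
Definition cauchy_seq_for (R : realType) (V : zmodType) (q : V -> R) (u : nat -> V) :=
  forall e : R, 0 < e -> exists N, forall m n, (N <= m)%N -> (N <= n)%N ->
    q (u m - u n) < e.

Definition cvg_seq_for (R : realType) (V : zmodType) (q : V -> R) (u : nat -> V) (l : V) :=
  forall e : R, 0 < e -> exists N, forall n, (N <= n)%N -> q (u n - l) < e.

HB.factory Record Lmodule_isHilbert (R : realType) (k : field_kind) V
    of GRing.Lmodule (scalar_field R k) V := {
  dot : V -> V -> scalar_field R k;
  dot_linearl : forall y, linear_for ( *%R ) (dot^~ y);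
  dot_conj : forall x y, dot y x = sconj (dot x y);
  dot_gt0 : forall x, x != 0 -> 0 < dot x x;
  dot_complete : forall u : nat -> V,
    cauchy_seq_for (fun x => sre (dot x x)) u ->
    exists l, cvg_seq_for (fun x => sre (dot x x)) u l
}.

HB.builders Context (R : realType) (k : field_kind) V of Lmodule_isHilbert R k V.
Local Notation F := (scalar_field R k).

Let dnormD := dnormD dot_linearl dot_conj dot_gt0.
Let dnormZ := dnormZ dot_linearl dot_conj dot_gt0.
Let dnorm_eq0 := dnorm_eq0 dot_linearl dot_gt0.
Let dnorm_sqr := dnorm_sqr dot_linearl dot_gt0.

HB.instance Definition _ := Lmodule_isNormed.Build F V dnormD dnormZ dnorm_eq0.

Let q (x : V) : R := sre (dot x x).

Lemma dnorm_complete (G : set_system V) : ProperFilter G -> cauchy G -> cvg G.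
Proof.
move=> GG /cauchyP Gc.
have inv_gt0 n : 0 < (sreal n.+1%:R^-1 : F) by rewrite -sreal0 ltr_sreal invr_gt0.
have ch n : {x : V | G (ball x (sreal n.+1%:R^-1 : F))} by apply/cid/Gc.
pose u n := sval (ch n).
have Gu n : G (ball (u n) (sreal n.+1%:R^-1 : F)) by exact: (svalP (ch n)).
have normE (x : V) : `|x| = sreal (Num.sqrt (q x)) :> F by [].
have archi (e : R) : 0 < e -> exists N, forall n, (N <= n)%N -> n.+1%:R^-1 < e.
  move=> e0; exists (Num.bound e^-1) => n Nn.
  rewrite invf_plt ?posrE//; apply: (lt_le_trans (archi_boundP _)).
    by rewrite invr_ge0 ltW.
  by rewrite ler_nat (leq_trans Nn).
have [|l ul] := @dot_complete u.
  move=> e e0; have /archi[N NP] : 0 < Num.sqrt e / 2 by rewrite divr_gt0// sqrtr_gt0.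
  exists N => m n Nm Nn.
  rewrite -/(q (u m - u n)) -ltr_sqrt// -(@ltr_sreal R k) -normE.
  have [x [xm xn]] := filter_ex (@filterI _ G _ _ _ (Gu m) (Gu n)).
  rewrite -(subrKA x) (le_lt_trans (ler_normD _ _))//.
  apply: lt_trans (ltrD xm _) _; first by rewrite distrC; exact: xn.
  by rewrite -srealD ltr_sreal [ltRHS]splitr ltrD// NP.
apply/cvg_ex; exists l; apply/cvgrPdist_lt => /= eps eps0.
pose e := sre eps; have epsE : eps = sreal e by rewrite ge0_sreK// ltW.
have e0 : 0 < e by rewrite -(@ltr_sreal R k) -epsE sreal0.
have e2 : 0 < e / 2 by rewrite divr_gt0.
have [N1 N1P] := archi _ e2.
have [|N2 N2P] := ul ((e / 2) ^+ 2); first by rewrite exprn_gt0.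
pose n := maxn N1 N2.
have /N2P un : (N2 <= n)%N by rewrite leq_maxr.
near=> x.
rewrite -(subrKA (u n)) (le_lt_trans (ler_normD _ _))// epsE (splitr e) srealD ltrD//.
  rewrite distrC normE ltr_sreal -[ltRHS]gtr0_norm// -sqrtr_sqr ltr_sqrt//.
  by rewrite exprn_gt0.
have : ball (u n) (sreal n.+1%:R^-1 : F) x by near: x; exact: Gu.
move=> /lt_trans; apply; rewrite ltr_sreal N1P// leq_maxl.
Unshelve. all: by end_near. Qed.

HB.instance Definition _ := Uniform_isComplete.Build V dnorm_complete.

HB.instance Definition _ :=
  isHilbert.Build R k V dot_linearl dot_conj (fun x => esym (dnorm_sqr x)).
HB.end.

Section HilbertTheory.
Context {R : realType} {k : field_kind}.
Local Notation F := (scalar_field R k).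
Variable V : hilbertType R k.
Implicit Types (x y z : V) (a : F).

(* The norm of a normed module takes its values in the field of scalars; [nrm]
   is the same norm as a real number. *)
Definition nrm x : R := sre `|x|.

Lemma normr_nrm x : `|x| = sreal (nrm x) :> F.
Proof. by rewrite ge0_sreK. Qed.
Lemma nrm_ge0 x : 0 <= nrm x.
Proof. by rewrite sre_ge0. Qed.
Lemma nrm0 : nrm 0 = 0.
Proof. by rewrite /nrm normr0 -sreal0 srealK. Qed.
Lemma nrmD x y : nrm (x + y) <= nrm x + nrm y.
Proof. by rewrite /nrm -sreD ler_sre// ler_normD. Qed.
Lemma nrmZ a x : nrm (a *: x) = sre `|a| * nrm x.
Proof. by rewrite /nrm normrZ -[`|a| in LHS]ge0_sreK// sre_srealM. Qed.
Lemma nrmN x : nrm (- x) = nrm x.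
Proof. by rewrite /nrm normrN. Qed.

Lemma nrm_dist x y : `|nrm x - nrm y| <= nrm (x - y).
Proof.
rewrite ler_norml; apply/andP; split.
  by rewrite lerNl opprB lerBlDr -(nrmN (x - y)) opprB -{1}(subrK x y) nrmD.
by rewrite lerBlDr -{1}(subrK y x) nrmD.
Qed.

Lemma innerDl x z y : inner (x + z) y = inner x y + inner z y.
Proof. exact: dotDl (@inner_linearl _ _ _) _ _ _. Qed.
Lemma inner0l y : inner 0 y = 0.
Proof. exact: dot0l (@inner_linearl _ _ _) _. Qed.
Lemma innerZl a x y : inner (a *: x) y = a * inner x y.
Proof. exact: dotZl (@inner_linearl _ _ _) _ _ _. Qed.
Lemma innerNl x y : inner (- x) y = - inner x y.
Proof. by rewrite -scaleN1r innerZl mulN1r. Qed.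
Lemma inner_gt0 x : x != 0 -> 0 < inner x x.
Proof. by move=> x0; rewrite inner_norm exprn_gt0// normr_gt0. Qed.
Lemma sre_inner x : sre (inner x x) = nrm x ^+ 2.
Proof. by rewrite inner_norm normr_nrm expr2 -srealM srealK. Qed.

Lemma inner_CS x y : `|inner x y| <= sreal (nrm x * nrm y).
Proof.
have := dot_CS (@inner_linearl _ _ _) (@inner_conj _ _ _) inner_gt0 x y.
by rewrite /dnorm -srealM !sre_inner !sqrtr_sqr !(ger0_norm (nrm_ge0 _)).
Qed.

Lemma hilbert_seq_complete (u : nat -> V) :
  cauchy_seq_for (fun x => sre (inner x x)) u ->
  exists l, cvg_seq_for (fun x => sre (inner x x)) u l.
Proof.
move=> uc.
have /cauchy_cvg/cvg_ex[l ul] : cauchy (u @ \oo).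
  apply/cauchyP => eps eps0.
  have e0 : 0 < sre eps by rewrite -(@ltr_sreal R k) ge0_sreK ?sreal0// ltW.
  have [|N NP] := uc (sre eps ^+ 2); first by rewrite exprn_gt0.
  exists (u N); exists N => // n /= Nn.
  have := NP _ _ (leqnn N) Nn.
  rewrite sre_inner ltr_pXn2r// ?nnegrE ?nrm_ge0 ?(ltW e0)//.
  by rewrite -(@ltr_sreal R k) -normr_nrm (ge0_sreK (ltW eps0)) -ball_normE.
exists l => e e0; move/cvgrPdist_lt : ul => /(_ (sreal (Num.sqrt e))) [].
  by rewrite -sreal0 ltr_sreal sqrtr_gt0.
move=> N _ NP; exists N => n /NP /=.
rewrite distrC normr_nrm ltr_sreal sre_inner => h.
by rewrite -[e]sqr_sqrtr ?ltW// ltr_pXn2r// ?nnegrE ?nrm_ge0 ?sqrtr_ge0.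
Qed.
End HilbertTheory.

(* The quotient V / N by a closed subspace N, identified as a Hilbert space with
   the orthogonal complement of N: a class is given by its unique
   representative orthogonal to N. *)
Section Quotient.
Context {R : realType} {k : field_kind} {V : hilbertType R k}.
Local Notation F := (scalar_field R k).
Variable N : set V.

Definition perp : {pred V} := [pred x | `[< forall z, N z -> inner x z = 0 >]].

Lemma perp_submod_closed : submod_closed perp.
Proof.
split; first by apply/asboolP => z _; rewrite inner0l.
move=> a x y /asboolP xN /asboolP yN; apply/asboolP => z Nz.
by rewrite innerDl innerZl xN// yN// mulr0 addr0.
Qed.

HB.instance Definition _ := GRing.isSubmodClosed.Build F V perp perp_submod_closed.

Record quotient := Quotient { qval :> V; _ : qval \in perp }.

HB.instance Definition _ := [isSub for qval].
HB.instance Definition _ := [Choice of quotient by <:].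
HB.instance Definition _ := [SubChoice_isSubLmodule of quotient by <:].

Let qinner (x y : quotient) : F := inner (qval x) (qval y).

Lemma qinner_linearl y : linear_for ( *%R ) (qinner^~ y).
Proof. by move=> a x z; rewrite /qinner/= innerDl innerZl. Qed.
Lemma qinner_conj x y : qinner y x = sconj (qinner x y).
Proof. exact: inner_conj. Qed.
Lemma qinner_gt0 x : x != 0 -> 0 < qinner x x.
Proof. by move=> x0; apply: inner_gt0. Qed.
Lemma qinner_complete (u : nat -> quotient) :
  cauchy_seq_for (fun x => sre (qinner x x)) u ->
  exists l, cvg_seq_for (fun x => sre (qinner x x)) u l.
Proof.
move=> uc; have [//|l ul] := @hilbert_seq_complete R k V (qval \o u).
suff lN : l \in perp by exists (Quotient lN).
apply/asboolP => z Nz; apply/eqP; rewrite -normr_eq0; apply/eqP/le_anti.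
rewrite normr_ge0 andbT -[leLHS]ge0_sreK// -[leRHS](@sreal0 R k) ler_sreal.
apply/ler_addgt0Pl => e e0; rewrite addr0.
have nz0 : 0 < nrm z + 1 by rewrite ltr_wpDl// nrm_ge0.
have [|M MP] := ul ((e / (nrm z + 1)) ^+ 2).
  by rewrite exprn_gt0// divr_gt0.
have uz0 : inner (qval (u M)) z = 0 by have /asboolP/(_ z Nz) := valP (u M).
have {MP} := MP _ (leqnn M); rewrite sre_inner ltr_pXn2r// ?nnegrE ?nrm_ge0//; last first.
  by rewrite ltW// divr_gt0.
move=> h.
have -> : inner l z = - inner (qval (u M) - l) z.
  by rewrite innerDl uz0 innerNl add0r opprK.
rewrite normrN; have := inner_CS (qval (u M) - l) z.
move=> /ler_sre; rewrite srealK => /le_trans; apply.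
rewrite ltr_pdivlMr// in h; apply: le_trans (ltW h).
by rewrite ler_wpM2l ?nrm_ge0// lerDl.
Qed.

HB.instance Definition _ := Lmodule_isHilbert.Build R k quotient
  qinner_linearl qinner_conj qinner_gt0 qinner_complete.
End Quotient.

Section Families.
Context {F : numFieldType} (I : Type) (E : I -> lmodType F).

Definition family_of := forall i, E i.
Implicit Types x y z : family_of.

HB.instance Definition _ := gen_eqMixin family_of.
HB.instance Definition _ := gen_choiceMixin family_of.

Let fadd x y : family_of := fun i => x i + y i.
Let fopp x : family_of := fun i => - x i.
Let fzero : family_of := fun i => 0.
Let fscale (a : F) x : family_of := fun i => a *: x i.

Lemma faddA : associative fadd.
Proof. by move=> x y z; apply: functional_extensionality_dep => i; apply: addrA. Qed.
Lemma faddC : commutative fadd.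
Proof. by move=> x y; apply: functional_extensionality_dep => i; apply: addrC. Qed.
Lemma fadd0 : left_id fzero fadd.
Proof. by move=> x; apply: functional_extensionality_dep => i; apply: add0r. Qed.
Lemma faddN : left_inverse fzero fopp fadd.
Proof. by move=> x; apply: functional_extensionality_dep => i; apply: addNr. Qed.

HB.instance Definition _ := GRing.isZmodule.Build family_of faddA faddC fadd0 faddN.

Lemma fscaleA a b x : fscale a (fscale b x) = fscale (a * b) x.
Proof. by apply: functional_extensionality_dep => i; apply: scalerA. Qed.
Lemma fscale1 : left_id 1 fscale.
Proof. by move=> x; apply: functional_extensionality_dep => i; apply: scale1r. Qed.
Lemma fscaleDr : right_distributive fscale +%R.
Proof. by move=> a x y; apply: functional_extensionality_dep => i; apply: scalerDr. Qed.
Lemma fscaleDl x : {morph fscale^~ x : a b / a + b}.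
Proof. by move=> a b; apply: functional_extensionality_dep => i; apply: scalerDl. Qed.

HB.instance Definition _ := GRing.Zmodule_isLmodule.Build F family_of
  fscaleA fscale1 fscaleDr fscaleDl.
End Families.

(* Hilbert direct sum of finitely many Hilbert spaces. *)
Section FiniteSum.
Context {R : realType} {k : field_kind} (I : finType) (E : I -> hilbertType R k).
Local Notation F := (scalar_field R k).

Definition fsum := @family_of F I E.

HB.instance Definition _ := GRing.Lmodule.on fsum.

Let finner (x y : fsum) : F := \sum_i inner (x i) (y i).

Lemma finner_linearl y : linear_for ( *%R ) (finner^~ y).
Proof.
move=> a x z; rewrite /finner mulr_sumr -big_split; apply: eq_bigr => i _ /=.
by rewrite -innerZl -innerDl.
Qed.
Lemma finner_conj x y : finner y x = sconj (finner x y).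
Proof.
rewrite /finner (big_morph _ (@sconjD R k) (@sconj0 R k)).
by apply: eq_bigr => i _; apply: inner_conj.
Qed.
Lemma sre_finner x : sre (finner x x) = \sum_i nrm (x i) ^+ 2.
Proof.
rewrite /finner (big_morph _ (@sreD R k) (_ : sre 0 = 0)).
  by apply: eq_bigr => i _; apply: sre_inner.
by rewrite -(@sreal0 R k) srealK.
Qed.
Lemma finner_gt0 x : x != 0 -> 0 < finner x x.
Proof.
move=> x0; rewrite lt_neqAle; apply/andP; split; last first.
  by apply: sumr_ge0 => i _; rewrite inner_norm exprn_ge0.
apply: contra x0 => /eqP/esym /eqP.
rewrite psumr_eq0; last by move=> i _; rewrite inner_norm exprn_ge0.
move=> /allP h; apply/eqP; apply: functional_extensionality_dep => i.
have := h i (mem_index_enum i).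
by rewrite inner_norm expf_eq0/= normr_eq0 => /eqP.
Qed.
Lemma finner_complete (u : nat -> fsum) :
  cauchy_seq_for (fun x => sre (finner x x)) u ->
  exists l, cvg_seq_for (fun x => sre (finner x x)) u l.
Proof.
move=> uc.
have /(_ _)/cid ch i : exists l : E i,
    cvg_seq_for (fun x => sre (inner x x)) (fun n => u n i) l.
  apply: hilbert_seq_complete => e /uc[N NP]; exists N => m n Nm Nn.
  apply: le_lt_trans (NP m n Nm Nn); rewrite sre_finner sre_inner (bigD1 i)//=.
  by rewrite lerDl sumr_ge0// => j _; rewrite exprn_ge0// nrm_ge0.
pose l : fsum := fun i => sval (ch i); have ul i := svalP (ch i).
exists l => e e0.
have c0 : 0 < e / #|I|.+1%:R by rewrite divr_gt0.
have /choice[N NP] i := ul i _ c0.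
exists (\max_i N i)%N => n Nn; rewrite sre_finner.
have : \sum_i nrm ((u n - l : fsum) i) ^+ 2 <= \sum_(i : I) e / #|I|.+1%:R.
  apply: ler_sum => i _; rewrite -sre_inner ltW//; apply: NP.
  by apply: leq_trans Nn; apply: leq_bigmax.
move=> /le_lt_trans; apply; rewrite sumr_const.
rewrite -(mulr_natr _ #|_|) -mulrA gtr_pMr// mulrC ltr_pdivrMr// mul1r ltr_nat.
exact: leqnn.
Qed.

HB.instance Definition _ := Lmodule_isHilbert.Build R k fsum
  finner_linearl finner_conj finner_gt0 finner_complete.
End FiniteSum.

Section ScalarSeries.
Context {R : realType} {k : field_kind}.
Local Notation F := (scalar_field R k).

Lemma sre_series (a : nat -> F) n : sre (series a n) = series (sre \o a) n.
Proof.
rewrite /series/= (big_morph _ (@sreD R k) (_ : sre 0 = 0))//.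
by rewrite -(@sreal0 R k) srealK.
Qed.

Lemma sim0 : sim (0 : F) = 0.
Proof. by apply: (addrI (sim (0 : F))); rewrite -simD !addr0. Qed.

Lemma sim_series (a : nat -> F) n : sim (series a n) = series (sim \o a) n.
Proof. by rewrite /series/= (big_morph _ (@simD R k) sim0). Qed.

Lemma sreB (z w : F) : sre (z - w) = sre z - sre w.
Proof. by rewrite sreD sreN. Qed.

Lemma cvg_sre (u : nat -> F) (l : F) :
  u @ \oo --> l -> (fun n => sre (u n)) @ \oo --> sre l.
Proof.
move=> ul; apply/cvgrPdist_lt => e e0.
move/cvgrPdist_lt : ul => /(_ (sreal e)) []; first by rewrite -sreal0 ltr_sreal.
move=> N _ NP; exists N => // n /NP /= h.
rewrite -sreB; apply: le_lt_trans (normr_sre _) _.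
by rewrite -(@ltr_sreal R k) ge0_sreK.
Qed.

Lemma cvg_sconj (u : nat -> F) (l : F) :
  u @ \oo --> l -> (fun n => sconj (u n)) @ \oo --> sconj l.
Proof.
move=> ul; apply/cvgrPdist_lt => e e0.
move/cvgrPdist_lt : ul => /(_ e e0) [N _ NP]; exists N => // n /NP /= h.
by rewrite -sconjN -sconjD normr_sconj.
Qed.

Lemma abs_summable_cvg (a : nat -> F) :
  cvgn (series (fun n => sre `|a n|)) -> cvgn (series a).
Proof.
move=> ac.
have cr : cvgn (series (sre \o a)).
  apply: normed_cvg; apply: series_le_cvg ac => n //=; first exact: sre_ge0.
  exact: normr_sre.
have ci : cvgn (series (sim \o a)).
  apply: normed_cvg; apply: series_le_cvg ac => n //=; first exact: sre_ge0.
  exact: normr_sim.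
apply/cvg_ex; exists (sreal (limn (series (sre \o a))) +
  sunit * sreal (limn (series (sim \o a)))).
apply/cvgrPdist_lt => eps eps0.
pose e := sre eps; have epsE : eps = sreal e by rewrite ge0_sreK// ltW.
have e0 : 0 < e by rewrite -(@ltr_sreal R k) -epsE sreal0.
have e2 : 0 < e / 2 by rewrite divr_gt0.
move/cvgrPdist_lt : cr => /(_ _ e2)[N1 _ N1P].
move/cvgrPdist_lt : ci => /(_ _ e2)[N2 _ N2P].
exists (maxn N1 N2) => // n /=; rewrite geq_max => /andP[/N1P h1 /N2P h2].
rewrite [series a n]scalarE sre_series sim_series opprD addrACA -mulrN -mulrDr.
rewrite -!srealN -!srealD (le_lt_trans (ler_normD _ _))//.
have nr (x : R) : `|sreal x : F| = sreal `|x|.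
  have [x0|x0] := leP 0 x; first by rewrite !ger0_norm// sreal_ge0.
  rewrite (ltr0_norm x0) srealN ler0_norm// -(@sreal0 R k) ler_sreal; exact: ltW.
rewrite epsE (splitr e) [ltRHS]srealD ltr_leD//; first by rewrite nr ltr_sreal.
rewrite normrM nr; apply: le_trans (_ : 1 * sreal (e / 2) <= _); last by rewrite mul1r.
by rewrite ler_pM// ?norm_sunit// ?sreal_ge0// ler_sreal ltW.
Qed.
End ScalarSeries.

(* Hilbert direct sum of countably many Hilbert spaces: the square-summable
   families, with inner product the sum of the series of inner products. *)
Section HilbertSum.
Context {R : realType} {k : field_kind} (E : nat -> hilbertType R k).
Local Notation F := (scalar_field R k).
Local Notation fam := (@family_of F nat E).

Definition square_summable : {pred fam} :=
  [pred x : fam | `[< cvgn (series (fun i => nrm (x i) ^+ 2)) >]].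

Lemma nrm_sqrD (V : hilbertType R k) (x y : V) :
  nrm (x + y) ^+ 2 <= (nrm x ^+ 2 + nrm y ^+ 2) *+ 2.
Proof.
have /le_trans : nrm (x + y) ^+ 2 <= (nrm x + nrm y) ^+ 2.
  by rewrite ler_pXn2r ?nnegrE ?addr_ge0 ?nrm_ge0 ?nrmD.
apply; have := sqr_ge0 (nrm x - nrm y); nra.
Qed.

Lemma square_summable_submod_closed : submod_closed square_summable.
Proof.
split.
  apply/asboolP; rewrite (_ : series _ = fun=> 0); first exact: is_cvg_cst.
  apply/funext => n; rewrite /series/= big1// => i _.
  by rewrite nrm0 expr0n.
move=> a x y /asboolP xs /asboolP ys; apply/asboolP.
pose b : R := sre `|a| ^+ 2.
apply: (@series_le_cvg _ _ (fun i => 2 * (b * nrm (x i) ^+ 2 + nrm (y i) ^+ 2))).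
- by move=> n; rewrite exprn_ge0// nrm_ge0.
- by move=> n; rewrite mulr_ge0// addr_ge0// ?mulr_ge0// ?exprn_ge0// ?nrm_ge0// sre_ge0.
- move=> n; apply: le_trans (nrm_sqrD _ _) _.
  by rewrite nrmZ exprMn mulr_natl.
have -> : (fun i => 2 * (b * nrm (x i) ^+ 2 + nrm (y i) ^+ 2)) =
    2 *: (b *: (fun i => nrm (x i) ^+ 2) + (fun i => nrm (y i) ^+ 2)) by [].
by apply: is_cvg_seriesZ; apply: is_cvg_seriesD => //; apply: is_cvg_seriesZ.
Qed.

HB.instance Definition _ := GRing.isSubmodClosed.Build F fam square_summable
  square_summable_submod_closed.

Record hsum := HSum { hval : fam; _ : hval \in square_summable }.

HB.instance Definition _ := [isSub for hval].
HB.instance Definition _ := [Choice of hsum by <:].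
HB.instance Definition _ := [SubChoice_isSubLmodule of hsum by <:].

Implicit Types x y z : hsum.

Lemma hsum_summable x : cvgn (series (fun i => nrm (hval x i) ^+ 2)).
Proof. by case: x => x /= /asboolP. Qed.

Let hinner x y : F := limn (series (fun i => inner (hval x i) (hval y i))).

Lemma cvg_hinner x y : series (fun i => inner (hval x i) (hval y i)) @ \oo --> hinner x y.
Proof.
apply: abs_summable_cvg.
apply: (@series_le_cvg _ _ (fun i => nrm (hval x i) ^+ 2 + nrm (hval y i) ^+ 2)).
- by move=> n; apply: sre_ge0.
- by move=> n; rewrite addr_ge0// exprn_ge0// nrm_ge0.
- move=> n; have /ler_sre := inner_CS (hval x n) (hval y n).
  rewrite srealK => /le_trans; apply.
  by have := sqr_ge0 (nrm (hval x n) - nrm (hval y n));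
     have := nrm_ge0 (hval x n); have := nrm_ge0 (hval y n); nra.
by apply: is_cvg_seriesD; apply: hsum_summable.
Qed.

Lemma hinner_linearl y : linear_for ( *%R ) (hinner^~ y).
Proof.
move=> a x z; apply: cvg_lim => //.
have -> : series (fun i => inner (hval (a *: x + z) i) (hval y i)) =
  (fun n => a * series (fun i => inner (hval x i) (hval y i)) n +
            series (fun i => inner (hval z i) (hval y i)) n).
  apply/funext => n; rewrite /series/= mulr_sumr -big_split.
  by apply: eq_bigr => i _; rewrite /= innerDl innerZl.
by apply: cvgD; [apply: cvgMr|]; apply: cvg_hinner.
Qed.

Lemma hinner_conj x y : hinner y x = sconj (hinner x y).
Proof.
apply: cvg_lim => //.
have -> : series (fun i => inner (hval y i) (hval x i)) =
  (fun n => sconj (series (fun i => inner (hval x i) (hval y i)) n)).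
  apply/funext => n; rewrite /series/= (big_morph _ (@sconjD R k) (@sconj0 R k)).
  by apply: eq_bigr => i _; apply: inner_conj.
exact/cvg_sconj/cvg_hinner.
Qed.

Lemma sre_hinner x : sre (hinner x x) = limn (series (fun i => nrm (hval x i) ^+ 2)).
Proof.
apply/esym/cvg_lim => //.
have -> : series (fun i => nrm (hval x i) ^+ 2) =
  (fun n => sre (series (fun i => inner (hval x i) (hval x i)) n)).
  apply/funext => n; rewrite sre_series /series/=.
  by apply: eq_bigr => i _; rewrite sre_inner.
exact/cvg_sre/cvg_hinner.
Qed.

Lemma nondecreasing_series_sqr (a : fam) :
  nondecreasing_seq (series (fun i => nrm (a i) ^+ 2)).
Proof. by apply: nondecreasing_series => n _ _; rewrite exprn_ge0// nrm_ge0. Qed.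

Lemma hinner_gt0 x : x != 0 -> 0 < hinner x x.
Proof.
move=> x0.
have sx i : nrm (hval x i) ^+ 2 <= sre (hinner x x).
  rewrite sre_hinner; apply: le_trans (_ : series (fun i => nrm (hval x i) ^+ 2) i.+1 <= _).
    rewrite /series/= big_nat_recr//= lerDr sumr_ge0// => j _.
    by rewrite exprn_ge0// nrm_ge0.
  exact: (nondecreasing_cvgn_le (@nondecreasing_series_sqr _) (@hsum_summable x)).
have hr : hinner x x = sreal (sre (hinner x x)).
  have := add_sconj (hinner x x); rewrite -hinner_conj mulr2n srealD -!mulr2n.
  by rewrite -[LHS]mulr_natr -[RHS]mulr_natr => /mulIf; apply; rewrite pnatr_eq0.
rewrite hr -(@sreal0 R k) ltr_sreal lt_neqAle; apply/andP; split; last first.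
  by apply: le_trans (sx 0%N); rewrite exprn_ge0// nrm_ge0.
apply: contra x0 => /eqP/esym q0; apply/eqP/val_inj.
apply: functional_extensionality_dep => i.
have := sx i; rewrite q0 => h.
have : nrm (hval x i) ^+ 2 == 0 by rewrite eq_le h exprn_ge0// nrm_ge0.
rewrite expf_eq0/= => /eqP n0; apply/eqP; rewrite -normr_eq0.
by rewrite normr_nrm n0 sreal0.
Qed.

Lemma hinner_complete (u : nat -> hsum) :
  cauchy_seq_for (fun x => sre (hinner x x)) u ->
  exists l, cvg_seq_for (fun x => sre (hinner x x)) u l.
Proof.
move=> uc.
pose s (a : fam) := series (fun i => nrm (a i) ^+ 2).
have sle x P : s (hval x) P <= sre (hinner x x).
  rewrite sre_hinner.
  exact: (nondecreasing_cvgn_le (@nondecreasing_series_sqr _) (@hsum_summable x)).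
have /(_ _)/cid ch i : exists l : E i,
    cvg_seq_for (fun w : E i => sre (inner w w)) (fun n => hval (u n) i) l.
  apply: hilbert_seq_complete => e /uc[N NP]; exists N => m n Nm Nn.
  apply: le_lt_trans (NP m n Nm Nn); apply: le_trans (sle _ i.+1).
  rewrite sre_inner /s /series/= big_nat_recr//= lerDr sumr_ge0// => j _.
  by rewrite exprn_ge0// nrm_ge0.
pose l : fam := fun i => sval (ch i).
have ul i : (fun m => nrm (hval (u m) i - l i)) @ \oo --> 0.
  apply/cvgrPdist_lt => e e0.
  have [|N NP] := svalP (ch i) (e ^+ 2); first by rewrite exprn_gt0.
  exists N => // n /NP; rewrite sre_inner ltr_pXn2r ?nnegrE ?nrm_ge0 ?(ltW e0)//.
  by rewrite sub0r normrN ger0_norm// nrm_ge0.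
have key e : 0 < e -> exists N, forall n, (N <= n)%N -> forall P,
    s (hval (u n) - l) P <= e.
  move=> /uc[N NP]; exists N => n Nn P.
  have c : (fun m => s (hval (u n - u m)) P) @ \oo --> s (hval (u n) - l) P.
    rewrite /s /series/=.
    apply: cvg_big => [|i _]; first by move=> ? ?; exact: add_continuous.
    have h : (fun m => nrm (hval (u n - u m) i)) @ \oo --> nrm ((hval (u n) - l) i).
      apply/cvgrPdist_lt => d d0; move/cvgrPdist_lt : (ul i) => /(_ d d0)[M _ MP].
      exists M => // m /MP; rewrite /= sub0r normrN (ger0_norm (nrm_ge0 _)).
      apply: le_lt_trans; apply: le_trans (nrm_dist _ _) _.
      have -> : (hval (u n) - l) i - hval (u n - u m) i = hval (u m) i - l i.
        rewrite -[(hval (u n) - l) i]/(hval (u n) i - l i).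
        rewrite -[hval (u n - u m) i]/(hval (u n) i - hval (u m) i).
        by rewrite opprB addrC subrKA.
      by [].
    by rewrite expr2; under eq_fun do rewrite expr2; apply: cvgM.
  apply: (@cvgr_to_le _ _ _ _ _ _ _ c).
  exists N => // m Nm; rewrite ltW//; apply: le_lt_trans (sle _ _) _.
  exact: NP.
have [N0 /(_ _ (leqnn _)) h0] := key 1 ltr01.
have ls : l \in square_summable.
  have d : hval (u N0) - l \in square_summable.
    apply/asboolP; apply: nondecreasing_is_cvgn; first exact: nondecreasing_series_sqr.
    by exists 1 => _ [P _ <-]; apply: h0.
  rewrite -[l](subKr (hval (u N0))); apply: rpredB => //; exact: (valP (u N0)).
exists (HSum ls) => e e0.
have [|N NP] := key (e / 2); first by rewrite divr_gt0.
exists N => n /NP h; rewrite sre_hinner.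
apply: le_lt_trans (_ : e / 2 < e); last by lra.
apply: limr_le; first exact: hsum_summable.
by apply: nearW => P; apply: h.
Qed.

HB.instance Definition _ := Lmodule_isHilbert.Build R k hsum
  hinner_linearl hinner_conj hinner_gt0 hinner_complete.
End HilbertSum.

Section Operators.
Context {R : realType} {k : field_kind}.
Implicit Types V W : hilbertType R k.

Definition opnorm V W (A : V -> W) : \bar R :=
  ereal_sup [set (nrm (A x))%:E | x in [set x | nrm x <= 1]].

Definition bounded_operator V W (A : V -> W) : Prop :=
  linear A /\ (opnorm A < +oo)%E.

(* The inverse of a bounded bijection of Hilbert spaces is bounded, by the
   open mapping theorem. *)
Definition bounded_isomorphism V W (A : V -> W) : Prop :=
  bounded_operator A /\ bijective A.

Definition ker V W (A : V -> W) : set V := [set x | A x = 0].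

(* [xget] is used as a definite description: the sets below are singletons when
   U is a closed subspace, A a bounded operator, A a bijection respectively. *)
Definition orth_proj V (U : set V) (y : V) : V :=
  xget 0 [set p | U p /\ forall u, U u -> inner (y - p) u = 0].

Definition adjoint V W (A : V -> W) (y : W) : V :=
  xget 0 [set x | forall z, inner (A z) y = inner z x].

Definition inverse V W (A : V -> W) (y : W) : V := xget 0 [set x | A x = y].

(* The comparison takes place in the scalar field, hence also says that the
   difference of the two forms is real-valued. *)
Definition loewner_le V (A B : V -> V) : Prop :=
  forall x, inner (A x) x <= inner (B x) x.

Definition coset V (N : set V) (c : V) : set V := [set c + z | z in N].

Definition is_coset V (N A : set V) : Prop := exists c, A = coset N c.

Definition quotient_norm V (N : set V) (c : V) : R :=
  inf [set nrm (c + z) | z in N].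

(* For a closed subspace N: the class [c], as the element of the orthogonal complement in c + N. *)
Definition quotient_class V (N : set V) (c : V) : quotient N :=
  xget 0 [set x : quotient N | coset N c (qval x)].
End Operators.

Section Levels.
Context {R : realType} {k : field_kind}.
Variables (H : hilbertType R k) (E : nat -> hilbertType R k).
Variable S : forall l, E l -> H.

(* Notation:
     Efin m = E^(m),  Sfin m = S^(m),  Vspace m = V_m,
     Rop l = R_l = (I - P_(l-1)) S_l,  Dop l = D_l = R_l^* R_l,
     Equot l = E_l / ker D_l,  Rhat l and Dhat l = the maps induced on it,
     Qfin m = E^(m) / ker S^(m),  Shat m = the map induced on it,
     Tfin m = the direct sum of the E_l / ker D_l,
     Cop m = C_m,  Lop m = L_m = C_m^*.
   Levels are numbered from 0, so that E^(m) consists of the levels l < m, and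
   the space spanned by the levels before level l is [Vspace l]. *)
Definition Efin (m : nat) : hilbertType R k := fsum (fun l : 'I_m => E l).

Definition Sfin (m : nat) (c : Efin m) : H := \sum_(l < m) S (c l).

Definition Vspace (m : nat) : set H := range (@Sfin m).

Definition Rop (l : nat) (x : E l) : H := S x - orth_proj (Vspace l) (S x).

Definition Dop (l : nat) : E l -> E l := adjoint (@Rop l) \o @Rop l.

Definition Equot (l : nat) : hilbertType R k := quotient (ker (@Dop l)).

Definition Rhat (l : nat) (x : Equot l) : H := Rop (qval x).

Definition Dhat (l : nat) (x : Equot l) : Equot l :=
  quotient_class (ker (@Dop l)) (Dop (qval x)).

Definition Qfin (m : nat) : hilbertType R k := quotient (ker (@Sfin m)).

Definition Shat (m : nat) (x : Qfin m) : H := Sfin (qval x).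

Definition Tfin (m : nat) : hilbertType R k := fsum (fun l : 'I_m => Equot l).

(* The unique bounded isomorphism C with Shat x = sum_l Rhat_l (C x)_l; it exists
   as soon as the spaces [Vspace] are closed. *)
Definition Cop (m : nat) : Qfin m -> Tfin m :=
  xget (fun=> 0) [set C : Qfin m -> Tfin m | bounded_isomorphism C /\
    forall x, Shat x = \sum_(l < m) Rhat (C x l)].

Definition Lop (m : nat) : Tfin m -> Qfin m := adjoint (@Cop m).

(* The embedding of E^(m) into E^(oo) by padding with zeros. *)
Definition pad_family (m : nat) (c : Efin m) : @family_of (scalar_field R k) nat E :=
  fun l => match @idP (l < m)%N with
           | ReflectT h => c (Ordinal h)
           | ReflectF _ => 0
           end.

Lemma pad_family_summable m (c : Efin m) : pad_family c \in @square_summable R k E.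
Proof.
apply/asboolP/cvg_ex.
exists (series (fun i => nrm (pad_family c i) ^+ 2) m).
apply: cvg_near_cst; exists m => // n /= mn.
rewrite /series/= (big_cat_nat (n := m))//= [X in _ + X]big1_seq ?addr0// => i.
rewrite mem_index_iota => /andP[_ /andP[mi _]].
rewrite /pad_family; case: {-}_ / idP => [im|_]; last by rewrite nrm0 expr0n.
by have := leq_trans im mi; rewrite ltnn.
Qed.

Definition pad (m : nat) (c : Efin m) : hsum E := HSum (pad_family_summable c).
End Levels.

Arguments Sfin {R k H E} S m c.
Arguments Vspace {R k H E} S m.
Arguments Rop {R k H E} S l x.
Arguments Dop {R k H E} S l x.
Arguments Rhat {R k H E} S l x.
Arguments Dhat {R k H E} S l x.
Arguments Shat {R k H E} S m x.
Arguments Cop {R k H E} S m x.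
Arguments Lop {R k H E} S m x.

(* Main.v *)
Require Import Defs.
From mathcomp Require Import all_boot all_order all_algebra.
From mathcomp Require Import ring lra.
From mathcomp Require Import all_classical all_reals all_analysis.

Import Order.TTheory GRing.Theory Num.Theory.
Import numFieldNormedType.Exports.

Set Implicit Arguments.
Unset Strict Implicit.
Unset Printing Implicit Defensive.

Local Open Scope classical_set_scope.
Local Open Scope ring_scope.

(* The ranges of the R_l are mutually orthogonal and R_1, ..., R_m together span
   V_m, by Gram-Schmidt; hence |S^(m) x|^2 = sum_l |R_l (C x)_l|^2, which lies
   between delta |C x|^2 and Delta |C x|^2. Since |L| <= M one has
   |C x| <= M |x|. Since |w| <= K |L w|, the image of L is closed, and its
   orthogonal complement is ker C = 0; so L is onto, and writing x = L w gives
   |x|^2 = <C x, w> <= K |C x| |x|. The lower bound on D_l makes C bounded, and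
   the bound on the inverse of L replaces the open mapping theorem.

   The upper bound is uniform in m, so for c in the Hilbert sum the vectors
   S^(m) c converge; passing to the limit in the lower bound, with the quotient
   norms controlled by ker S^(m) being contained in ker S, bounds S below on
   the quotient, and the rest follows by projecting onto ker S. *)

(** * Inner products, real-valued norms and sequential limits in a Hilbert space *)

Section InnerProduct.
Context {R : realType} {k : field_kind} {V : hilbertType R k}.
Local Notation F := (scalar_field R k).
Implicit Types (x y z : V) (a : F).

Lemma sre0 : sre (0 : F) = 0.
Proof. by rewrite -(@sreal0 R k) srealK. Qed.

Lemma innerDr x y z : inner x (y + z) = inner x y + inner x z.
Proof. by rewrite inner_conj innerDl sconjD -!inner_conj. Qed.

Lemma innerZr a x y : inner x (a *: y) = sconj a * inner x y.
Proof. by rewrite inner_conj innerZl sconjM -inner_conj. Qed.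

Lemma inner0r x : inner x 0 = 0.
Proof. by rewrite inner_conj inner0l sconj0. Qed.

Lemma innerNr x y : inner x (- y) = - inner x y.
Proof. by rewrite inner_conj innerNl sconjN -inner_conj. Qed.

Lemma innerBl x y z : inner (x - y) z = inner x z - inner y z.
Proof. by rewrite innerDl innerNl. Qed.

Lemma innerBr x y z : inner x (y - z) = inner x y - inner x z.
Proof. by rewrite innerDr innerNr. Qed.

Lemma nrm_eq0 x : nrm x = 0 -> x = 0.
Proof. by move=> h; apply/eqP; rewrite -normr_eq0 normr_nrm h sreal0. Qed.

Lemma nrm_gt0 x : x != 0 -> 0 < nrm x.
Proof.
by move=> x0; rewrite lt_neqAle nrm_ge0 andbT; apply: contra_neq x0 => /esym/nrm_eq0.
Qed.

Lemma inner_eq0 x : inner x x = 0 -> x = 0.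
Proof.
move=> h; apply: nrm_eq0; apply/eqP; rewrite -sqrf_eq0.
by rewrite -sre_inner h sre0.
Qed.

Lemma innerC0 x y : inner x y = 0 -> inner y x = 0.
Proof. by rewrite (inner_conj x y) => ->; rewrite sconj0. Qed.

Lemma inner_nrm x : inner x x = sreal (nrm x ^+ 2).
Proof. by rewrite inner_norm normr_nrm expr2 -srealM -expr2. Qed.

Lemma nrmBC x y : nrm (x - y) = nrm (y - x).
Proof. by rewrite -nrmN opprB. Qed.

Lemma sre_innerC x y : sre (inner y x) = sre (inner x y).
Proof. by rewrite inner_conj sre_conj. Qed.

Lemma sqr_nrmD x y :
  nrm (x + y) ^+ 2 = nrm x ^+ 2 + 2 * sre (inner x y) + nrm y ^+ 2.
Proof.
by rewrite -!sre_inner innerDl !innerDr !sreD (sre_innerC x y); ring.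
Qed.

Lemma sqr_nrmB x y :
  nrm (x - y) ^+ 2 = nrm x ^+ 2 - 2 * sre (inner x y) + nrm y ^+ 2.
Proof. by rewrite sqr_nrmD nrmN innerNr sreN mulrN. Qed.

Lemma pythagoras x y : inner x y = 0 ->
  nrm (x + y) ^+ 2 = nrm x ^+ 2 + nrm y ^+ 2.
Proof. by rewrite sqr_nrmD => ->; rewrite sre0 mulr0 addr0. Qed.

Lemma sre_inner_CS x y : sre (inner x y) <= nrm x * nrm y.
Proof.
by apply: le_trans (sre_norm _) _; have /ler_sre := inner_CS x y; rewrite srealK.
Qed.

Lemma nrmZ_real (t : R) x : 0 <= t -> nrm (sreal t *: x) = t * nrm x.
Proof. by move=> t0; rewrite nrmZ ger0_norm ?srealK// sreal_ge0. Qed.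

Lemma nrm_sum I (r : seq I) (P : pred I) (f : I -> V) :
  nrm (\sum_(i <- r | P i) f i) <= \sum_(i <- r | P i) nrm (f i).
Proof.
elim/big_rec2 : _ => [|i a b _ h]; first by rewrite nrm0.
by apply: le_trans (nrmD _ _) _; rewrite lerD2l.
Qed.

(** The norm behind the topology takes its values in the scalar field; passing to [nrm] reduces
    limits to real sequences for both kinds of scalars at once. *)
Lemma cvg_nrmP (u : nat -> V) (l : V) :
  u @ \oo --> l <-> (fun n => nrm (u n - l)) @ \oo --> 0.
Proof.
split=> [/cvgrPdist_lt h|/cvgrPdist_lt h]; apply/cvgrPdist_lt => e e0.
  have /h[N _ NP] : 0 < (sreal e : F) by rewrite -sreal0 ltr_sreal.
  exists N => // n /NP /=; rewrite distrC normr_nrm ltr_sreal.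
  by rewrite sub0r normrN ger0_norm ?nrm_ge0.
have e0' : 0 < sre e by rewrite -(@ltr_sreal R k) ge0_sreK ?sreal0// ltW.
have [N _ NP] := h _ e0'; exists N => // n /NP /=.
rewrite sub0r normrN ger0_norm ?nrm_ge0// distrC normr_nrm.
by rewrite -(@ltr_sreal R k) (ge0_sreK (ltW e0)).
Qed.

Lemma cvg_nrm (u : nat -> V) (l : V) :
  u @ \oo --> l -> (fun n => nrm (u n)) @ \oo --> nrm l.
Proof.
move=> /cvg_nrmP/cvgrPdist_lt h; apply/cvgrPdist_lt => e /h[N _ NP].
exists N => // n /NP /=; rewrite sub0r normrN ger0_norm ?nrm_ge0// => /le_lt_trans; apply.
by rewrite nrmBC nrm_dist.
Qed.

Lemma nrm_cauchy_cvg (u : nat -> V) :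
  (forall e : R, 0 < e -> exists N, forall m n, (N <= m)%N -> (N <= n)%N ->
    nrm (u m - u n) < e) -> cvgn u.
Proof.
move=> uc; have [|l ul] := @hilbert_seq_complete R k V u.
  move=> e e0; have /uc[N NP] : 0 < Num.sqrt e by rewrite sqrtr_gt0.
  exists N => m n Nm Nn; rewrite sre_inner -[ltRHS]sqr_sqrtr ?ltW//.
  by rewrite ltr_pXn2r ?nnegrE ?nrm_ge0 ?sqrtr_ge0// NP.
apply/cvg_ex; exists l; apply/cvg_nrmP/cvgrPdist_lt => e e0.
have [|N NP] := ul (e ^+ 2); first by rewrite exprn_gt0.
exists N => // n /NP; rewrite sre_inner ltr_pXn2r ?nnegrE ?nrm_ge0 ?(ltW e0)//.
by rewrite sub0r normrN ger0_norm// nrm_ge0.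
Qed.

Lemma closed_nrmP (U : set V) :
  closed U <-> forall l, (forall e : R, 0 < e -> exists2 u, U u & nrm (l - u) < e) -> U l.
Proof.
split=> [Uc l lU|h].
  apply: Uc => B /nbhs_ballP[e /= e0 eB].
  have e0' : 0 < sre e by rewrite -(@ltr_sreal R k) ge0_sreK ?sreal0// ltW.
  have [u Uu lu] := lU _ e0'; exists u; split => //; apply: eB.
  by rewrite -ball_normE /= normr_nrm -(ge0_sreK (ltW e0)) ltr_sreal.
move=> l lU; apply: h => e e0.
have e0' : 0 < (sreal e : F) by rewrite -sreal0 ltr_sreal.
have [u [Uu]] := lU _ (nbhsx_ballx l _ e0').
rewrite -ball_normE /= normr_nrm ltr_sreal => lu.
by exists u.
Qed.

Lemma closed_cvg (U : set V) (u : nat -> V) l :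
  closed U -> (forall n, U (u n)) -> u @ \oo --> l -> U l.
Proof.
move=> /closed_nrmP Uc uU /cvg_nrmP/cvgrPdist_lt ul; apply: Uc => e /ul[N _ /(_ N)].
rewrite /= leqnn sub0r normrN ger0_norm ?nrm_ge0// => /(_ isT) h.
by exists (u N); rewrite // nrmBC.
Qed.

End InnerProduct.

(** * Orthogonal projection onto a closed subspace, and the quotient norm *)

Definition linear_subspace (R : realType) (k : field_kind) (V : hilbertType R k)
  (U : set V) : Prop :=
  U 0 /\ forall a x y, U x -> U y -> U (a *: x + y).

Section Projection.
Context {R : realType} {k : field_kind} {V : hilbertType R k}.
Local Notation F := (scalar_field R k).
Variable U : set V.
Hypotheses (Usub : linear_subspace U) (Uclosed : closed U).

Lemma subspaceD x y : U x -> U y -> U (x + y).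
Proof. by move=> /(Usub.2 1) h /h; rewrite scale1r. Qed.
Lemma subspaceZ a x : U x -> U (a *: x).
Proof. by move=> Ux; have := Usub.2 a x 0 Ux Usub.1; rewrite addr0. Qed.
Lemma subspaceB x y : U x -> U y -> U (x - y).
Proof. by move=> Ux Uy; apply: subspaceD => //; rewrite -scaleN1r; apply: subspaceZ. Qed.

(** A sequence in [U] whose distances to [y] tend to the infimum is Cauchy by the parallelogram law;
    it converges by completeness, and closedness keeps the limit in [U]. *)
Lemma closest_point y :
  exists2 p, U p & forall u, U u -> nrm (y - p) <= nrm (y - u).
Proof.
pose D := [set nrm (y - u) | u in U]; pose d : R := inf D.
have hD : has_inf D.
  split; first by exists (nrm (y - 0)), 0 => //; exact: Usub.1.
  by exists 0 => _ [u _ <-]; rewrite nrm_ge0.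
have dle u : U u -> d <= nrm (y - u) by move=> Uu; apply: ge_inf; [exact: hD.2|exists u].
have d0 : 0 <= d.
  by apply: lb_le_inf; [exact: hD.1|move=> _ [u _ <-]; exact: nrm_ge0].
have /choice[u uP] (n : nat) : exists u, U u /\ nrm (y - u) < d + n.+1%:R^-1.
  have /(inf_adherent)/(_ hD) : 0 < n.+1%:R^-1 :> R by rewrite invr_gt0.
  by move=> [_ [v Uv <-] h]; exists v.
(* Parallelogram law for [y - u m] and [y - u n]: the midpoint of [u m] and [u n] lies in [U], hence
   at distance at least [d] from [y]. *)
have key m n : nrm (u m - u n) ^+ 2 <=
    2 * nrm (y - u m) ^+ 2 + 2 * nrm (y - u n) ^+ 2 - 4 * d ^+ 2.
  have : d <= nrm (y - 2^-1 *: (u m + u n)).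
    by apply: dle; apply: subspaceZ; apply: subspaceD; apply: (uP _).1.
  have -> : y - 2^-1 *: (u m + u n) = 2^-1 *: ((y - u m) + (y - u n)).
    rewrite addrACA -opprD scalerBr -mulr2n -[y *+ 2]scaler_nat scalerA.
    by rewrite mulVf ?pnatr_eq0// scale1r.
  have -> : nrm (2^-1 *: ((y - u m) + (y - u n))) = 2^-1 * nrm ((y - u m) + (y - u n)).
    rewrite (_ : 2^-1 = sreal (2^-1) :> F) ?nrmZ_real//.
    apply: (@mulfI _ 2); first by rewrite pnatr_eq0.
    rewrite mulfV ?pnatr_eq0// (_ : 2 = sreal 2 :> F) -?srealM ?mulfV ?sreal1//.
    by rewrite -[2 in RHS]/(1 + 1) srealD sreal1.
  move=> h.
  have -> : u m - u n = (y - u n) - (y - u m) by rewrite opprB [RHS]addrC subrKA.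
  rewrite nrmBC.
  have h2 : 4 * d ^+ 2 <= nrm (y - u m + (y - u n)) ^+ 2.
    move: h; set w := nrm _ => h; have {}h : 2 * d <= w by lra.
    by rewrite (_ : 4 * d ^+ 2 = (2 * d) ^+ 2) ?ler_pXn2r ?nnegrE ?nrm_ge0 ?mulr_ge0//; ring.
  by move: h2; rewrite (sqr_nrmD _ (y - u n)) (sqr_nrmB (y - u m)); lra.
(* With [i = 1/(n+1)], the square of [d + i] is at most [d ^+ 2 + (2 * d + 1) * i] because
   [i <= 1]. *)
have bd n : nrm (y - u n) ^+ 2 <= d ^+ 2 + (2 * d + 1) * n.+1%:R^-1.
  have [_ /ltW h] := uP n.
  have i1 : n.+1%:R^-1 <= 1 :> R by rewrite invf_le1 ?ler1n.
  have i0 : 0 <= n.+1%:R^-1 :> R by rewrite invr_ge0.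
  have := nrm_ge0 (y - u n); move: i0 i1 h; set i := n.+1%:R^-1; set w := nrm _.
  by move=> *; nra.
have inv_le N n : (N <= n)%N -> n.+1%:R^-1 <= N.+1%:R^-1 :> R.
  by move=> Nn; rewrite lef_pV2 ?posrE// ler_nat.
have /cvg_ex[p up] : cvgn u.
  apply: nrm_cauchy_cvg => e e0.
  (* By [key] and [bd], the squared distance of two terms of index at least N is at most
     4(2d+1)/(N+1), which is below [e ^+ 2] once N+1 exceeds [c]. *)
  pose c := 4 * (2 * d + 1) / e ^+ 2.
  have c0 : 0 <= c by rewrite divr_ge0 ?exprn_ge0 ?mulr_ge0 ?addr_ge0 ?mulr_ge0// ltW.
  exists (Num.bound c) => m n Nm Nn.
  rewrite -(@ltr_pXn2r _ 2)// ?nnegrE ?nrm_ge0 ?(ltW e0)//.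
  apply: le_lt_trans (key m n) _.
  have hm := bd m; have hn := bd n.
  have i1 := inv_le _ _ Nm; have i2 := inv_le _ _ Nn.
  have hc : c < (Num.bound c).+1%:R.
    by apply: lt_le_trans (archi_boundP c0) _; rewrite ler_nat.
  have hc' : 4 * (2 * d + 1) * (Num.bound c).+1%:R^-1 < e ^+ 2.
    by rewrite ltr_pdivrMr// -ltr_pdivrMl ?exprn_gt0// mulrC.
  have D0 : 0 <= 2 * d + 1 by rewrite addr_ge0// mulr_ge0.
  move: hm hn hc' (ler_wpM2l D0 i1) (ler_wpM2l D0 i2); rewrite -mulrA.
  by do 3!move: (_ / _.+1%:R) => ?; lra.
exists p; first by apply: closed_cvg up => // n; exact: (uP n).1.
move=> v Uv; apply: le_trans (dle v Uv).
apply/ler_addgt0Pr => e e0.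
have e2 : 0 < e / 2 by rewrite divr_gt0.
move/cvg_nrmP/cvgrPdist_lt : up => /(_ _ e2)[N _ NP].
pose n := maxn N (Num.bound (e / 2)^-1).
have := NP n; rewrite /= sub0r normrN ger0_norm ?nrm_ge0// leq_maxl => /(_ isT) h1.
have [_ h2] := uP n.
have h3 : n.+1%:R^-1 <= e / 2.
  rewrite invf_ple ?posrE//; apply: ltW; apply: lt_le_trans (archi_boundP _) _.
    by rewrite invr_ge0 ltW.
  by rewrite ler_nat (leq_trans (leq_maxr N _))// leqnSn.
have := nrmD (y - u n) (u n - p); rewrite subrKA.
by move: h2 h3; move: (n.+1%:R^-1) => i; lra.
Qed.

(** The residual of a closest point is orthogonal to [U], since otherwise a move along some [u] in
    [U] would shorten it. *)
Lemma orth_proj_ex y :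
  exists p, U p /\ forall u, U u -> inner (y - p) u = 0.
Proof.
have [p Up pP] := closest_point y; exists p; split=> // u Uu.
have [->|u0] := eqVneq u 0; first by rewrite inner0r.
have uu : inner u u != 0 by rewrite gt_eqF// inner_gt0.
(* The coefficient that makes [y - p - a *: u] orthogonal to [u]; Pythagoras and minimality then
   force [a *: u] to vanish. *)
pose a := inner (y - p) u / inner u u.
have := pP (p + a *: u) (subspaceD Up (subspaceZ a Uu)).
rewrite -(@ler_pXn2r _ 2)// ?nnegrE ?nrm_ge0//.
have <- : (y - p - a *: u) + a *: u = y - p by rewrite subrK.
have -> : y - (p + a *: u) = y - p - a *: u by rewrite opprD addrA.
have o : inner (y - p - a *: u) (a *: u) = 0.
  by rewrite innerZr innerBl innerZl /a divfK// subrr mulr0.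
rewrite pythagoras// gerDl => h.
have /nrm_eq0/eqP : nrm (a *: u) = 0.
  by apply/eqP; rewrite -sqrf_eq0 eq_le h exprn_ge0// nrm_ge0.
rewrite scaler_eq0 (negbTE u0) orbF => /eqP a0.
by move: o; rewrite a0 scale0r subr0 addr0 -(divfK uu (inner (y - p) u)) -/a a0 mul0r.
Qed.

Lemma orth_projP y :
  U (orth_proj U y) /\ forall u, U u -> inner (y - orth_proj U y) u = 0.
Proof.
have [p hp] := orth_proj_ex y.
exact: (@xgetI _ 0 [set p | U p /\ forall u, U u -> inner (y - p) u = 0] p hp).
Qed.

Lemma orth_proj_in y : U (orth_proj U y). Proof. exact: (orth_projP y).1. Qed.

Lemma orth_proj_perp y u : U u -> inner (y - orth_proj U y) u = 0.
Proof. exact: (orth_projP y).2. Qed.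

Lemma orth_proj_uniq y p :
  U p -> (forall u, U u -> inner (y - p) u = 0) -> orth_proj U y = p.
Proof.
move=> Up pP; apply/eqP; rewrite -subr_eq0; apply/eqP/inner_eq0.
have Uq := orth_proj_in y; have Upq := subspaceB Uq Up.
have -> : inner (orth_proj U y - p) (orth_proj U y - p) =
    inner ((y - p) - (y - orth_proj U y)) (orth_proj U y - p).
  by congr inner; rewrite opprB [RHS]addrC subrKA.
by rewrite innerBl pP// orth_proj_perp// subrr.
Qed.

Lemma orth_proj_linear : linear (orth_proj U).
Proof.
move=> a x y; apply: orth_proj_uniq.
  by apply: Usub.2; exact: orth_proj_in.
move=> u Uu; rewrite opprD addrACA -scalerBr innerDl innerZl.
by rewrite !orth_proj_perp// mulr0 addr0.
Qed.

Lemma pythagoras_proj y :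
  nrm y ^+ 2 = nrm (orth_proj U y) ^+ 2 + nrm (y - orth_proj U y) ^+ 2.
Proof.
rewrite -pythagoras; first by rewrite addrC subrK.
exact/innerC0/orth_proj_perp/orth_proj_in.
Qed.

Lemma nrm_orth_projC y : nrm (y - orth_proj U y) <= nrm y.
Proof.
rewrite -(@ler_pXn2r _ 2)// ?nnegrE ?nrm_ge0// [leRHS]pythagoras_proj lerDr.
by rewrite exprn_ge0// nrm_ge0.
Qed.

Lemma orth_projC_perp y : y - orth_proj U y \in perp U.
Proof. by apply/asboolP => u; exact: orth_proj_perp. Qed.

(** Pythagoras for y + u = (y - P y) + (P y + u), whose second term lies in [U]. *)
Lemma nrm_orth_projC_le y u : U u -> nrm (y - orth_proj U y) <= nrm (y + u).
Proof.
move=> Uu; rewrite -(@ler_pXn2r _ 2)// ?nnegrE ?nrm_ge0//.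
rewrite -[in leRHS](subrK (orth_proj U y) y) -addrA [leRHS]pythagoras.
  by rewrite lerDl exprn_ge0// nrm_ge0.
by rewrite orth_proj_perp//; apply: subspaceD => //; exact: orth_proj_in.
Qed.

(** The infimum is attained at the component of [y] orthogonal to [U], so that estimates of quotient
    norms become estimates of vectors of [V]. *)
Lemma quotient_normE y : quotient_norm U y = nrm (y - orth_proj U y).
Proof.
apply/le_anti/andP; split.
  apply: ge_inf; first by exists 0 => _ [u _ <-]; rewrite nrm_ge0.
  exists (- orth_proj U y) => //.
  by rewrite -[- _]sub0r; apply: subspaceB; [exact: Usub.1|exact: orth_proj_in].
apply: lb_le_inf; first by exists (nrm (y + 0)), 0 => //; exact: Usub.1.
by move=> _ [u Uu <-]; exact: nrm_orth_projC_le.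
Qed.

Lemma quotient_classP y : coset U y (qval (quotient_class U y)).
Proof.
apply: (@xgetI _ 0 [set x : quotient U | coset U y (qval x)]
  (Defs.Quotient (orth_projC_perp y))).
exists (- orth_proj U y) => //.
by rewrite -[- _]sub0r; apply: subspaceB; [exact: Usub.1|exact: orth_proj_in].
Qed.

End Projection.

Section QuotientNorm.
Context {R : realType} {k : field_kind} {V : hilbertType R k}.
Variable N : set V.

Lemma inner_quotient (x y : quotient N) : inner x y = inner (qval x) (qval y).
Proof. by []. Qed.

Lemma nrm_quotient (x : quotient N) : nrm x = nrm (qval x).
Proof.
apply/eqP; rewrite -(@eqrXn2 _ 2)// ?nrm_ge0//; apply/eqP.
by rewrite -[LHS]sre_inner -[RHS]sre_inner.
Qed.

End QuotientNorm.

(** * Linear maps, operator norms and bounded operators *)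

Section LinearMaps.
Context {R : realType} {k : field_kind} {V W : hilbertType R k}.
Local Notation F := (scalar_field R k).
Variable A : V -> W.
Hypothesis Alin : linear A.

Lemma linearmapD x y : A (x + y) = A x + A y.
Proof. by have := Alin 1 x y; rewrite !scale1r. Qed.
Lemma linearmap0 : A 0 = 0.
Proof. by apply: (addrI (A 0)); rewrite -linearmapD !addr0. Qed.
Lemma linearmapZ a x : A (a *: x) = a *: A x.
Proof. by have := Alin a x 0; rewrite linearmap0 !addr0. Qed.
Lemma linearmapN x : A (- x) = - A x.
Proof. by rewrite -scaleN1r linearmapZ scaleN1r. Qed.
Lemma linearmapB x y : A (x - y) = A x - A y.
Proof. by rewrite linearmapD linearmapN. Qed.

Lemma ker_subspace : linear_subspace (ker A).
Proof.
by split=> [|a x y]; rewrite /ker/= ?linearmap0// Alin => -> ->; rewrite scaler0 addr0.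
Qed.

Lemma range_subspace : linear_subspace (range A).
Proof.
split; first by exists 0; rewrite ?linearmap0.
by move=> a _ _ [x _ <-] [y _ <-]; exists (a *: x + y); rewrite ?Alin.
Qed.

Lemma linearmap_inj : (forall x, A x = 0 -> x = 0) -> injective A.
Proof.
move=> h x y xy; apply/eqP; rewrite -subr_eq0; apply/eqP/h.
by rewrite linearmapB xy subrr.
Qed.

Lemma opnorm_leP (C : R) : 0 <= C ->
  (opnorm A <= C%:E)%E <-> forall x, nrm (A x) <= C * nrm x.
Proof.
move=> C0; split=> [h x|h].
  have [->|x0] := eqVneq x 0; first by rewrite linearmap0 !nrm0 mulr0.
  have n0 := nrm_gt0 x0; rewrite -ler_pdivrMr// mulrC.
  rewrite -nrmZ_real ?invr_ge0 ?nrm_ge0// -linearmapZ -lee_fin.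
  apply: le_trans h; apply: ereal_sup_ubound; eexists; last reflexivity.
  by rewrite /= nrmZ_real ?invr_ge0 ?nrm_ge0// mulVf// gt_eqF.
apply: ge_ereal_sup => _ [x /= x1 <-]; rewrite lee_fin.
by apply: le_trans (h x) _; rewrite -[leRHS]mulr1 ler_wpM2l.
Qed.

Lemma opnorm_ltyP :
  (opnorm A < +oo)%E <-> exists2 C, 0 <= C & forall x, nrm (A x) <= C * nrm x.
Proof.
have o0 : (0 <= opnorm A)%E.
  by apply: ereal_sup_ubound; exists 0; rewrite /= ?linearmap0 nrm0.
split=> [ofin|[C C0 CA]]; last first.
  by apply: le_lt_trans (ltry C); apply/opnorm_leP.
have ofn : opnorm A \is a fin_num by rewrite ge0_fin_numE.
exists (fine (opnorm A)); first exact: fine_ge0.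
by apply/opnorm_leP; rewrite ?fine_ge0// fineK.
Qed.

End LinearMaps.

(** The value at 0 enters the supremum and has nonnegative norm. The map is arbitrary so that this
    applies to [inverse (Lop S m)], which is given only by a definite description. *)
Lemma opnorm_bound_ge0 (R : realType) (k : field_kind) (V W : hilbertType R k)
    (A : V -> W) (B : R) :
  (opnorm A <= B%:E)%E -> 0 <= B.
Proof.
move=> h; rewrite -lee_fin; apply: le_trans h.
apply: (@le_trans _ _ (nrm (A 0))%:E); first by rewrite lee_fin nrm_ge0.
by apply: ereal_sup_ubound; exists 0; rewrite //= nrm0.
Qed.

Section BoundedOperators.
Context {R : realType} {k : field_kind} {V W : hilbertType R k}.
Local Notation F := (scalar_field R k).
Variable A : V -> W.
Hypothesis Abnd : bounded_operator A.

Lemma bounded_operator_cvg (u : nat -> V) l :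
  u @ \oo --> l -> (A \o u) @ \oo --> A l.
Proof.
have [C C0 CA] := (opnorm_ltyP Abnd.1).1 Abnd.2.
move=> /cvg_nrmP ul; apply/cvg_nrmP.
have cvC : (fun n => C * nrm (u n - l)) @ \oo --> 0.
  by rewrite -(mulr0 C); apply: cvgMr.
apply: (squeeze_cvgr _ (@cvg_cst _ (0 : R) _ _ _) cvC).
by apply: nearW => n; rewrite nrm_ge0 /= -(linearmapB Abnd.1) CA.
Qed.

Lemma ker_closed : closed (ker A).
Proof.
have [C C0 CA] := (opnorm_ltyP Abnd.1).1 Abnd.2.
apply/closed_nrmP => l lA; apply: nrm_eq0.
apply/eqP; rewrite eq_le nrm_ge0 andbT; apply/ler_addgt0Pl => e e0; rewrite addr0.
have C1 : 0 < C + 1 by rewrite ltr_wpDl.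
have [|u Au lu] := lA (e / (C + 1)); first by rewrite divr_gt0.
have -> : A l = A (l - u) by rewrite (linearmapB Abnd.1) Au subr0.
apply: le_trans (CA _) _; move: lu; rewrite ltr_pdivlMr// => lu.
have := nrm_ge0 (l - u); nra.
Qed.

End BoundedOperators.

(** * Riesz representation, adjoints and closed ranges *)

Section Riesz.
Context {R : realType} {k : field_kind}.
Local Notation F := (scalar_field R k).

(** Riesz representation of the functional sending z to <A z, y>: if it is not zero, a multiple of
    any nonzero vector orthogonal to its kernel represents it. *)
Lemma adjoint_ex (V W : hilbertType R k) (A : V -> W) (y : W) :
  bounded_operator A -> exists x, forall z, inner (A z) y = inner z x.
Proof.
move=> Abnd; have Alin := Abnd.1; pose f z := inner (A z) y.
have fD a x z : f (a *: x + z) = a * f x + f z by rewrite /f Alin innerDl innerZl.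
have f0 : f 0 = 0 by rewrite /f (linearmap0 Alin) inner0l.
have fZ a x : f (a *: x) = a * f x by have := fD a x 0; rewrite f0 !addr0.
pose N : set V := [set z | f z = 0].
have Ns : linear_subspace N.
  by split=> [|a u v]; rewrite /N/=// fD => -> ->; rewrite mulr0 addr0.
have Nc : closed N.
  have [C C0 CA] := (opnorm_ltyP Alin).1 Abnd.2.
  apply/closed_nrmP => l lN; apply/eqP; rewrite -normr_eq0; apply/eqP.
  rewrite -[LHS]ge0_sreK//; apply/eqP; rewrite -[X in _ == X](@sreal0 R k).
  apply/eqP; congr sreal; apply/eqP; rewrite eq_le sre_ge0// andbT.
  apply/ler_addgt0Pl => e e0; rewrite addr0.
  have C1 : 0 < C * nrm y + 1 by rewrite ltr_wpDl// mulr_ge0// nrm_ge0.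
  have [|u Nu lu] := lN (e / (C * nrm y + 1)); first by rewrite divr_gt0.
  have -> : f l = f (l - u).
    by rewrite -[l - u]addrC -scaleN1r fD Nu mulr0 add0r.
  have /ler_sre := inner_CS (A (l - u)) y; rewrite srealK => /le_trans; apply.
  move: lu; rewrite ltr_pdivlMr// => lu.
  have := CA (l - u); have := nrm_ge0 (l - u); have := nrm_ge0 y.
  have := nrm_ge0 (A (l - u)); nra.
have [Nall|/existsNP[w wN]] := pselect (forall z, N z).
  by exists 0 => z; rewrite inner0r; exact: Nall.
pose v := w - orth_proj N w.
have fv : f v != 0.
  apply/eqP => fv; apply: wN; rewrite -[w](subrK (orth_proj N w)).
  by apply: (subspaceD Ns) => //; exact: orth_proj_in.
have v0 : v != 0 by apply: contra_neq fv => ->.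
have vv : inner v v != 0 by rewrite gt_eqF// inner_gt0.
(* The vector [f v *: z - f z *: v] is in the kernel of [f], hence orthogonal to [v]; solving for
   [f z] gives the coefficient, conjugated because it sits in the second argument of [inner]. *)
exists (sconj (f v / inner v v) *: v) => z; rewrite innerZr sconjK -/(f z).
have : inner (f v *: z + (- f z) *: v) v = 0.
  apply/innerC0/(orth_proj_perp Ns Nc).
  by rewrite /N/= fD fZ mulNr mulrC subrr.
rewrite innerDl !innerZl mulNr => /eqP; rewrite subr_eq0 => /eqP h.
by rewrite mulrAC h mulfK.
Qed.

Lemma adjointP (V W : hilbertType R k) (A : V -> W) : bounded_operator A ->
  forall y z, inner (A z) y = inner z (adjoint A y).
Proof.
move=> Ab y; have [x xP] := adjoint_ex y Ab.
exact: (@xgetI _ 0 [set x | forall z, inner (A z) y = inner z x] x xP).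
Qed.

Lemma inner_inj (V : hilbertType R k) (x y : V) :
  (forall z, inner z x = inner z y) -> x = y.
Proof.
move=> h; apply/eqP; rewrite -subr_eq0; apply/eqP/inner_eq0.
by rewrite innerBr h subrr.
Qed.

Lemma adjoint_linear (V W : hilbertType R k) (A : V -> W) :
  bounded_operator A -> linear (adjoint A).
Proof.
move=> Ab a x y; apply: inner_inj => z.
by rewrite -adjointP// !innerDr !innerZr !adjointP.
Qed.

End Riesz.

(** The lower bound makes preimages of a convergent sequence of values Cauchy, and their limit is
    mapped to the limit of the values. *)
Lemma closed_range (R : realType) (k : field_kind) (V W : hilbertType R k)
    (A : V -> W) (K : R) :
  bounded_operator A -> (forall x, nrm x <= K * nrm (A x)) -> closed (range A).
Proof.
move=> Ab AK; have Alin := Ab.1; apply/closed_nrmP => l lA.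
(* The sign of [K] is unknown; the larger constant [|K| + 1] is positive and can be divided by. *)
have K1 : 0 < `|K| + 1 by rewrite ltr_wpDl.
have AK' x : nrm x <= (`|K| + 1) * nrm (A x).
  apply: le_trans (AK x) _; rewrite ler_wpM2r ?nrm_ge0//.
  by apply: le_trans (ler_norm K) _; rewrite lerDl.
have /choice[u uP] (n : nat) : exists u, nrm (l - A u) < n.+1%:R^-1.
  by have [|_ [u _ <-] h] := lA n.+1%:R^-1; [rewrite invr_gt0|exists u].
have small (e : R) : 0 < e -> exists N, forall n, (N <= n)%N -> nrm (l - A (u n)) < e.
  move=> e0; exists (Num.bound e^-1) => n Nn; apply: lt_trans (uP n) _.
  rewrite invf_plt ?posrE//; apply: (lt_le_trans (archi_boundP _)).
    by rewrite invr_ge0 ltW.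
  by rewrite ler_nat (leq_trans Nn).
have Aul : (A \o u) @ \oo --> l.
  apply/cvg_nrmP/cvgrPdist_lt => e /small[N NP].
  by exists N => // n /NP /=; rewrite sub0r normrN ger0_norm ?nrm_ge0// nrmBC.
have /cvg_ex[x ux] : cvgn u.
  apply: nrm_cauchy_cvg => e e0.
  have [|N NP] := small (e / (`|K| + 1) / 2); first by rewrite !divr_gt0.
  exists N => m n /NP hm /NP hn.
  apply: le_lt_trans (AK' _) _; rewrite mulrC -ltr_pdivlMr// (linearmapB Alin).
  have -> : A (u m) - A (u n) = (l - A (u n)) - (l - A (u m)).
    by rewrite opprB [RHS]addrC subrKA.
  by apply: le_lt_trans (nrmD _ _) _; rewrite nrmN; lra.
by exists x => //; rewrite -(cvg_lim _ Aul)// (cvg_lim _ (bounded_operator_cvg Ab ux)).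
Qed.

Lemma bounded_bijection (R : realType) (k : field_kind) (V W : hilbertType R k)
    (A : V -> W) (C : R) :
  linear A -> 0 <= C -> (forall x, nrm (A x) <= C * nrm x) -> injective A ->
  (forall y, exists x, A x = y) -> bounded_isomorphism A.
Proof.
move=> Alin C0 CA Ai As; split; first by split=> //; apply/opnorm_ltyP => //; exists C.
have /choice[g gP] := As; exists g => // x; exact/Ai/gP.
Qed.

(** * Norms and padding in finite direct sums *)

Section FiniteSums.
Context {R : realType} {k : field_kind} {I : finType} {E : I -> hilbertType R k}.

Lemma sqr_nrm_fsum (x : fsum E) : nrm x ^+ 2 = \sum_i nrm (x i) ^+ 2.
Proof. by rewrite -sre_inner; exact: sre_finner. Qed.

Lemma nrm_fsum_coord (x : fsum E) i : nrm (x i) <= nrm x.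
Proof.
rewrite -(@ler_pXn2r _ 2)// ?nnegrE ?nrm_ge0// sqr_nrm_fsum (bigD1 i)//= lerDl.
by apply: sumr_ge0 => j _; rewrite exprn_ge0// nrm_ge0.
Qed.

End FiniteSums.

Lemma pad_familyE (R : realType) (k : field_kind) (E : nat -> hilbertType R k) m
  (c : Efin E m) (l : 'I_m) : pad_family c l = c l.
Proof.
case: l => l lm; rewrite /pad_family /=; case: {-}_ / idP => // lm'.
by rewrite (bool_irrelevance lm' lm).
Qed.

(** * The spaces V_m and the operators R_l and D_l *)

Section Levels.
Context {R : realType} {k : field_kind} {H : hilbertType R k}.
Context {E : nat -> hilbertType R k} {S : forall l, E l -> H}.
Arguments S : clear implicits.
Hypothesis S_bounded : forall l, bounded_operator (S l).
Hypothesis V_closed : forall m, (0 < m)%N -> closed (Vspace S m).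
Local Notation F := (scalar_field R k).

Lemma Sfin_linear m : linear (Sfin S m).
Proof.
move=> a x y; rewrite /Sfin scaler_sumr -big_split; apply: eq_bigr => l _ /=.
exact: (S_bounded l).1.
Qed.

Lemma Sfin_bounded m : bounded_operator (Sfin S m).
Proof.
split; first exact: Sfin_linear.
have /choice[C CP] l : exists C, 0 <= C /\ forall x, nrm (S l x) <= C * nrm x.
  have [C C0 CS] := (opnorm_ltyP (S_bounded l).1).1 (S_bounded l).2.
  by exists C.
apply/opnorm_ltyP; first exact: Sfin_linear.
exists (\sum_(l < m) C l); first by apply: sumr_ge0 => l _; exact: (CP l).1.
move=> x; apply: le_trans (nrm_sum _ _ _) _; rewrite mulr_suml; apply: ler_sum => l _.
apply: le_trans ((CP l).2 _) _; rewrite ler_wpM2l ?(CP l).1//.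
exact: (@nrm_fsum_coord _ _ _ (fun l : 'I_m => E l)).
Qed.

(** The coefficients are taken from one family over all levels, so that an induction on [m] does not
    change their type. *)
Lemma VspaceP m y :
  Vspace S m y <-> exists c : forall l, E l, y = \sum_(l < m) S l (c l).
Proof.
split=> [[c _ <-]|[c ->]]; last by exists (fun l : 'I_m => c l).
by exists (pad_family c); apply: eq_bigr => l _; rewrite pad_familyE.
Qed.

Lemma Vspace_subspace m : linear_subspace (Vspace S m).
Proof. exact: (range_subspace (@Sfin_linear m)). Qed.

Lemma Vspace_closed m : closed (Vspace S m).
Proof.
(* Closedness is assumed for m >= 1 only; V_0 is zero, because its elements are empty sums. *)
case: m => [|m]; last exact: V_closed.
apply/closed_nrmP => l lV; have /nrm_eq0 -> : nrm l = 0; last first.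
  exact: (Vspace_subspace 0).1.
apply/eqP; rewrite eq_le nrm_ge0 andbT; apply/ler_addgt0Pl => e /lV[_ [u _ <-]].
by rewrite /Sfin big_ord0 subr0 addr0 => /ltW.
Qed.

Lemma Vspace_step m y x : Vspace S m y -> Vspace S m.+1 (y + S m x).
Proof.
move=> /VspaceP[c ->]; apply/VspaceP; exists (dfwith c m x).
rewrite big_ord_recr /= dfwithin; congr (_ + _); apply: eq_bigr => l _ /=.
by rewrite dfwithout// gtn_eqF.
Qed.

Lemma Vspace_le m n y : (m <= n)%N -> Vspace S m y -> Vspace S n y.
Proof.
move=> /subnK <-; elim: (n - m)%N => // i IH /IH yV.
by rewrite addSn -[y]addr0 -(linearmap0 (S_bounded (i + m)).1); exact: Vspace_step.
Qed.

Lemma Rop_perp l x u : Vspace S l u -> inner (Rop S l x) u = 0.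
Proof. exact: (orth_proj_perp (Vspace_subspace l) (@Vspace_closed l)). Qed.

Lemma Rop_linear l : linear (Rop S l).
Proof.
move=> a x y; rewrite /Rop (S_bounded l).1.
rewrite (orth_proj_linear (Vspace_subspace l) (@Vspace_closed l)).
by rewrite opprD addrACA -scalerBr.
Qed.

Lemma Rop_bounded l : bounded_operator (Rop S l).
Proof.
split; first exact: Rop_linear.
have [C C0 CS] := (opnorm_ltyP (S_bounded l).1).1 (S_bounded l).2.
apply/opnorm_ltyP; first exact: Rop_linear.
exists C => // x; apply: le_trans (CS x).
exact: (nrm_orth_projC (Vspace_subspace l) (@Vspace_closed l)).
Qed.

Lemma Rop_Vspace l x : Vspace S l.+1 (Rop S l x).
Proof.
rewrite /Rop addrC; apply: Vspace_step; rewrite -scaleN1r.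
apply: (subspaceZ (Vspace_subspace l)).
exact: (orth_proj_in (Vspace_subspace l) (@Vspace_closed l)).
Qed.

Lemma inner_Dop l x y : inner (Dop S l x) y = inner (Rop S l x) (Rop S l y).
Proof.
by rewrite [LHS]inner_conj [RHS]inner_conj (adjointP (Rop_bounded l)).
Qed.

(** Both inclusions follow from <D x, y> = <R x, R y>. As a consequence [Rop] is constant on the
    classes of [Equot]. *)
Lemma ker_Dop l : ker (Dop S l) = ker (Rop S l).
Proof.
apply/seteqP; split=> x; rewrite /ker /= => h.
  by apply: inner_eq0; rewrite -inner_Dop h inner0l.
apply: inner_eq0; rewrite inner_Dop h.
by rewrite inner0l.
Qed.

Lemma quotient_class_ker l x :
  exists2 n, Rop S l n = 0 & qval (quotient_class (ker (Dop S l)) x) = x + n.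
Proof.
have [||n nN <-] := @quotient_classP _ _ _ (ker (Dop S l)) _ _ x.
- by rewrite ker_Dop; exact/ker_subspace/Rop_linear.
- by rewrite ker_Dop; exact/ker_closed/Rop_bounded.
by exists n => //; move: nN; rewrite ker_Dop.
Qed.

Lemma Rhat_class l x : Rhat S l (quotient_class (ker (Dop S l)) x) = Rop S l x.
Proof.
have [n n0 e] := quotient_class_ker x.
by rewrite /Rhat e (linearmapD (@Rop_linear l)) n0 addr0.
Qed.

Lemma Rhat_linear l : linear (Rhat S l).
Proof. by move=> a x y; exact: Rop_linear. Qed.

(** The representative of the class of D x differs from D x by an element of ker D, to which [x] is
    orthogonal. This turns the Loewner bounds on [Dhat] into bounds on [Rhat]. *)
Lemma inner_Dhat l (x : Equot S l) :
  inner (Dhat S l x) x = sreal (nrm (Rhat S l x) ^+ 2).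
Proof.
have [n n0 e] := quotient_class_ker (Dop S l (qval x)).
have nN : ker (Dop S l) n by rewrite ker_Dop.
rewrite inner_quotient /Dhat e innerDl inner_Dop inner_nrm.
have /asboolP/(_ _ nN)/innerC0 -> := valP x.
by rewrite addr0.
Qed.

(** * Orthogonal synthesis from the R_l, and existence of C_m *)

Section Bounds.
Variables delta Delta : R.
Hypothesis delta_gt0 : 0 < delta.
Hypothesis D_lower : forall l,
  loewner_le (fun x : Equot S l => sreal delta *: x) (Dhat S l).
Hypothesis D_upper : forall l,
  loewner_le (Dhat S l) (fun x : Equot S l => sreal Delta *: x).

Lemma Rhat_lower l (x : Equot S l) : delta * nrm x ^+ 2 <= nrm (Rhat S l x) ^+ 2.
Proof.
have := D_lower x.
by rewrite inner_Dhat innerZl inner_nrm -srealM ler_sreal.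
Qed.

Lemma Rhat_upper l (x : Equot S l) : nrm (Rhat S l x) ^+ 2 <= Delta * nrm x ^+ 2.
Proof.
have := D_upper x.
by rewrite inner_Dhat innerZl inner_nrm -srealM ler_sreal.
Qed.

(** The synthesis from the orthogonalized levels; C_m has to satisfy [Rsum (C x) = Shat x]. *)
Definition Rsum m (t : Tfin S m) : H := \sum_(l < m) Rhat S l (t l).

Lemma Rsum_linear m : linear (@Rsum m).
Proof.
move=> a x y; rewrite /Rsum scaler_sumr -big_split; apply: eq_bigr => l _ /=.
exact: Rhat_linear.
Qed.

Lemma Rsum_family m (t : Tfin S m) :
  Rsum t = \sum_(l < m) Rhat S l (@pad_family R k (Equot S) m t l).
Proof. by apply: eq_bigr => l _; rewrite pad_familyE. Qed.

Lemma sum_Rhat_Vspace m (z : forall l, Equot S l) :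
  Vspace S m (\sum_(l < m) Rhat S l (z l)).
Proof.
elim: m => [|m IH]; first by rewrite big_ord0; exact: (Vspace_subspace 0).1.
rewrite big_ord_recr/=; apply: (subspaceD (Vspace_subspace _)).
  exact: Vspace_le IH.
exact: Rop_Vspace.
Qed.

(** Pythagoras, one level at a time: the first [m] terms add up to an element of V_m, and the range
    of R_m is orthogonal to V_m. *)
Lemma sqr_nrm_Rsum m (t : Tfin S m) :
  nrm (Rsum t) ^+ 2 = \sum_(l < m) nrm (Rhat S l (t l)) ^+ 2.
Proof.
rewrite Rsum_family.
under [RHS]eq_bigr do rewrite -(@pad_familyE R k (Equot S) m t).
move: (pad_family _) => z; elim: m {t} => [|m IH].
  by rewrite !big_ord0 nrm0 expr0n.
rewrite !big_ord_recr/= pythagoras ?IH//.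
exact/innerC0/Rop_perp/sum_Rhat_Vspace.
Qed.

Lemma Rsum_lower m (t : Tfin S m) : delta * nrm t ^+ 2 <= nrm (Rsum t) ^+ 2.
Proof.
rewrite sqr_nrm_Rsum sqr_nrm_fsum mulr_sumr; apply: ler_sum => l _.
exact: Rhat_lower.
Qed.

Lemma Rsum_upper m (t : Tfin S m) : nrm (Rsum t) ^+ 2 <= Delta * nrm t ^+ 2.
Proof.
rewrite sqr_nrm_Rsum sqr_nrm_fsum mulr_sumr; apply: ler_sum => l _.
exact: Rhat_upper.
Qed.

Lemma Rsum_inj m : injective (@Rsum m).
Proof.
apply: linearmap_inj => [|t t0]; first exact: Rsum_linear.
apply: nrm_eq0; apply/eqP; rewrite -sqrf_eq0 eq_le exprn_ge0 ?nrm_ge0// andbT.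
by rewrite -(ler_pM2l delta_gt0) mulr0; have := Rsum_lower t; rewrite t0 nrm0 expr0n.
Qed.

(* Gram-Schmidt: V_(m+1) is the orthogonal sum of V_m and the image of R_m. *)
Lemma Rsum_onto m y : Vspace S m y -> exists t : Tfin S m, Rsum t = y.
Proof.
move=> yV; suff [z ->] : exists z : forall l, Equot S l, y = \sum_(l < m) Rhat S l (z l).
  by exists (fun l : 'I_m => z l).
elim: m y yV => [|m IH] y /VspaceP[c ->]; first by exists (fun=> 0); rewrite !big_ord0.
rewrite big_ord_recr /=; set s := \sum_(_ < _) _.
have sV : Vspace S m s by apply/VspaceP; exists c.
pose p := orth_proj (Vspace S m) (S m (c m)).
have pV : Vspace S m p.
  exact: (orth_proj_in (Vspace_subspace m) (@Vspace_closed m)).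
(* Since S_m c_m = R_m c_m + p with [p] in V_m, the induction hypothesis is applied to [s + p]. *)
have [z zE] := IH _ (subspaceD (Vspace_subspace m) sV pV).
exists (dfwith z m (quotient_class (ker (Dop S m)) (c m))).
rewrite big_ord_recr /= dfwithin Rhat_class.
under eq_bigr => l _ do rewrite /= dfwithout ?gtn_eqF//.
by rewrite -zE /Rop -/p -addrA [p + _]addrC subrK.
Qed.

Lemma ker_Sfin_subspace m : linear_subspace (ker (Sfin S m)).
Proof. exact/ker_subspace/Sfin_linear. Qed.

Lemma ker_Sfin_closed m : closed (ker (Sfin S m)).
Proof. exact/ker_closed/Sfin_bounded. Qed.

Lemma Shat_linear m : linear (Shat S m).
Proof. by move=> a x y; exact: Sfin_linear. Qed.

Lemma Shat_inj m : injective (Shat S m).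
Proof.
apply: linearmap_inj => [|x x0]; first exact: Shat_linear.
apply: inner_eq0; have /asboolP := valP x; exact.
Qed.

(** The witness is the component of [c] orthogonal to the kernel; it carries estimates on [Qfin]
    over to [quotient_norm]. *)
Lemma Shat_class m (c : Efin E m) : exists2 x : Qfin S m,
  Shat S m x = Sfin S m c & nrm x = quotient_norm (ker (Sfin S m)) c.
Proof.
have Ns := @ker_Sfin_subspace m; have Nc := @ker_Sfin_closed m.
exists (Defs.Quotient (orth_projC_perp Ns Nc c)).
  rewrite /Shat/= (linearmapB (@Sfin_linear m)).
  have := orth_proj_in Ns Nc c; rewrite /ker/= => ->; exact: subr0.
by rewrite nrm_quotient/= quotient_normE.
Qed.

(** [Rsum] is a bijection onto V_m, so C x can be chosen as the preimage of [Shat x]. Linearity of C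
    comes from injectivity of [Rsum], and injectivity of C from that of [Shat]. *)
Lemma Cop_spec m : bounded_isomorphism (Cop S m) /\
  forall x, Shat S m x = \sum_(l < m) Rhat S l (Cop S m x l).
Proof.
have /choice[C CP] (x : Qfin S m) : exists t : Tfin S m, Rsum t = Shat S m x.
  by apply: Rsum_onto; exists (qval x).
pose P := [set C : Qfin S m -> Tfin S m | bounded_isomorphism C /\
  forall x, Shat S m x = \sum_(l < m) Rhat S l (C x l)].
suff : P C by exact: (@xgetI _ (fun=> 0) P C).
split; last by move=> x; rewrite -CP.
have [B B0 BS] := (opnorm_ltyP (@Sfin_linear m)).1 (Sfin_bounded m).2.
(* [B] bounds [Sfin S m], and [Rsum] is bounded below by the square root of [delta]. *)
apply: (@bounded_bijection _ _ _ _ _ (B / Num.sqrt delta)).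
- move=> a x y; apply: Rsum_inj; rewrite CP (@Rsum_linear m) !CP; exact: Shat_linear.
- by rewrite divr_ge0// sqrtr_ge0.
- move=> x; rewrite mulrAC ler_pdivlMr ?sqrtr_gt0//.
  apply: le_trans (BS (qval x)); rewrite -/(Shat S m x) -CP.
  rewrite -(@ler_pXn2r _ 2)// ?nnegrE ?mulr_ge0 ?nrm_ge0 ?sqrtr_ge0//.
  by rewrite exprMn sqr_sqrtr ?(ltW delta_gt0)// mulrC; exact: Rsum_lower.
- by move=> x y xy; apply: Shat_inj; rewrite -!CP xy.
- move=> t; have : Vspace S m (Rsum t) by rewrite Rsum_family; exact: sum_Rhat_Vspace.
  move=> [c _ cE]; have [x xE _] := Shat_class c.
  by exists x; apply: Rsum_inj; rewrite CP xE.
Qed.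

(** * Bounds on C_m from those on its adjoint L_m *)

Section FactorBounds.
Variables (M K : R) (m : nat).
Hypothesis L_bound : (opnorm (Lop S m) <= M%:E)%E.
Hypothesis Linv_bound : (opnorm (inverse (Lop S m)) <= K%:E)%E.

Let C := Cop S m.
Let L := Lop S m.
Let Cbnd : bounded_operator C := (Cop_spec m).1.1.
Let Cbij : bijective C := (Cop_spec m).1.2.
Let Llin : linear L := adjoint_linear Cbnd.

(** By duality |C x|^2 = <x, L (C x)> <= |x| M |C x|. *)
Lemma Cop_upper (x : Qfin S m) : nrm (C x) <= M * nrm x.
Proof.
have M0 := opnorm_bound_ge0 L_bound.
have [->|Cx0] := eqVneq (C x) 0; first by rewrite nrm0 mulr_ge0// nrm_ge0.
rewrite -(ler_pM2l (nrm_gt0 Cx0)) -expr2 -sre_inner (adjointP Cbnd).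
apply: le_trans (sre_inner_CS _ _) _.
have LC : nrm (L (C x)) <= M * nrm (C x) := (opnorm_leP Llin M0).1 L_bound (C x).
by rewrite [leRHS]mulrC [leRHS]mulrAC [leRHS]mulrC ler_wpM2l ?nrm_ge0.
Qed.

(** C is onto, so w = C v for some v, and |w|^2 = <v, L w>. *)
Lemma Lop_inj : injective L.
Proof.
apply: linearmap_inj => // w w0; apply: inner_eq0.
have [g _ gK] := Cbij; rewrite -{1}(gK w) (adjointP Cbnd) -/L -/(Lop S m) -/L w0.
by rewrite inner0r.
Qed.

Lemma inverse_Lop w : inverse L (L w) = w.
Proof.
apply: Lop_inj.
exact: (@xgetI _ 0 [set x | L x = L w] w erefl).
Qed.

Lemma Lop_lower w : nrm w <= K * nrm (L w).
Proof.
have [->|w0] := eqVneq w 0; first by rewrite (linearmap0 Llin) !nrm0 mulr0.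
have Lw0 : L w != 0.
  by apply: contra_neq w0 => h; apply: Lop_inj; rewrite h (linearmap0 Llin).
have n0 := nrm_gt0 Lw0.
rewrite -ler_pdivrMr// mulrC -nrmZ_real ?invr_ge0 ?nrm_ge0// -lee_fin.
apply: le_trans Linv_bound; apply: ereal_sup_ubound.
(* The normalized [L w] is written as the image of a rescaled [w], where [inverse_Lop] gives the
   value of the inverse. *)
exists (L (sreal (nrm (L w))^-1 *: w)); last by rewrite [inverse _ _]inverse_Lop.
by rewrite /= (linearmapZ Llin) nrmZ_real ?invr_ge0 ?nrm_ge0// mulVf// gt_eqF.
Qed.

(* The image of L is closed by [Lop_lower], and its orthogonal complement is
   ker C = 0. *)
Lemma Lop_onto x : exists w, L w = x.
Proof.
have Lb : bounded_operator L.
  by split; [exact: Llin|exact: le_lt_trans L_bound (ltry _)].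
have rc : closed (range L) := closed_range Lb Lop_lower.
have rs : linear_subspace (range L) := range_subspace Llin.
have [w _ wE] := orth_proj_in rs rc x.
exists w; rewrite wE; apply/esym/eqP; rewrite -subr_eq0; apply/eqP.
have Ci := bij_inj Cbij; apply: Ci; rewrite (linearmap0 Cbnd.1).
apply: inner_eq0; rewrite (adjointP Cbnd); apply: (orth_proj_perp rs rc).
by exists (C (x - orth_proj (range L) x)).
Qed.

Lemma Cop_lower (x : Qfin S m) : nrm x <= K * nrm (C x).
Proof.
have [->|x0] := eqVneq x 0; first by rewrite (linearmap0 Cbnd.1) !nrm0 mulr0.
have [w wE] := Lop_onto x.
rewrite -(ler_pM2r (nrm_gt0 x0)) -expr2 -sre_inner -{2}wE -(adjointP Cbnd).
apply: le_trans (sre_inner_CS _ _) _; rewrite mulrAC mulrC.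
by rewrite ler_wpM2r ?nrm_ge0// -wE; exact: Lop_lower.
Qed.

Lemma Sfin_lower c :
  delta / K ^+ 2 * quotient_norm (ker (Sfin S m)) c ^+ 2 <= nrm (Sfin S m c) ^+ 2.
Proof.
have [x <- <-] := Shat_class c.
(* The inverse of 0 is 0 by convention, so the left-hand side vanishes for K = 0. *)
have [->|K0] := eqVneq K 0.
  by rewrite expr0n invr0 mulr0 mul0r exprn_ge0// nrm_ge0.
have K2 : 0 < K ^+ 2 by rewrite exprn_even_gt0.
rewrite mulrAC ler_pdivrMr// (Cop_spec m).2 -/(Rsum _) mulrC.
apply: le_trans (_ : K ^+ 2 * (delta * nrm (C x) ^+ 2) <= _); last first.
  by rewrite mulrC ler_wpM2r ?(ltW K2)//; exact: Rsum_lower.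
rewrite mulrC [leRHS]mulrCA ler_wpM2l ?(ltW delta_gt0)// -exprMn.
rewrite ler_pXn2r ?nnegrE ?nrm_ge0 ?mulr_ge0 ?(opnorm_bound_ge0 Linv_bound) ?nrm_ge0//.
exact: Cop_lower.
Qed.

Lemma Sfin_upper c : 0 <= Delta ->
  nrm (Sfin S m c) ^+ 2 <= Delta * M ^+ 2 * quotient_norm (ker (Sfin S m)) c ^+ 2.
Proof.
move=> Delta0; have [x <- <-] := Shat_class c.
rewrite (Cop_spec m).2 -/(Rsum _); apply: le_trans (Rsum_upper _) _.
rewrite -mulrA ler_wpM2l// -exprMn.
rewrite ler_pXn2r ?nnegrE ?nrm_ge0 ?mulr_ge0 ?(opnorm_bound_ge0 L_bound) ?nrm_ge0//.
exact: Cop_upper.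
Qed.

End FactorBounds.
End Bounds.
End Levels.

(** * Cosets of a kernel, minimum-norm representatives, and closed range from a bound on the
    quotient *)

Section Cosets.
Context {R : realType} {k : field_kind} {V W : hilbertType R k}.

(** Every element of the coset is [p] plus an element of [N] orthogonal to [p]; by Pythagoras the
    norm is minimal only if that element is zero. *)
Lemma min_norm_coset (N A : set V) :
  linear_subspace N -> closed N -> is_coset N A ->
  exists! c, A c /\ forall c', A c' -> nrm c <= nrm c'.
Proof.
move=> Ns Nc [c0 ->]; pose p := c0 - orth_proj N c0.
have Np := orth_proj_in Ns Nc c0.
exists p; split.
  split; last by move=> _ [z Nz <-]; exact: nrm_orth_projC_le.
  by exists (- orth_proj N c0) => //; rewrite -scaleN1r; exact: subspaceZ.
move=> _ [[z Nz <-] cmin].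
have pA : nrm (c0 + z) <= nrm p.
  apply: cmin; exists (- orth_proj N c0) => //.
  by rewrite -scaleN1r; exact: subspaceZ.
have Nz' : N (orth_proj N c0 + z) by exact: subspaceD.
have cE : c0 + z = p + (orth_proj N c0 + z) by rewrite addrA subrK.
have : nrm (orth_proj N c0 + z) ^+ 2 <= 0.
  rewrite -(lerD2l (nrm p ^+ 2)) addr0 -pythagoras; last exact: orth_proj_perp.
  by rewrite -cE ler_pXn2r ?nnegrE ?nrm_ge0.
move=> h; rewrite cE [X in _ = _ + X](_ : _ = 0) ?addr0//; apply: nrm_eq0.
by apply/eqP; rewrite -sqrf_eq0 eq_le h exprn_ge0// nrm_ge0.
Qed.

(** The class is the whole fibre over [f]: two coefficients with the same image differ by an element
    of the kernel. *)
Lemma unique_coset (A : V -> W) (f : W) : linear A -> range A f ->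
  exists! B : set V, is_coset (ker A) B /\ A @` B = [set f].
Proof.
move=> Alin [c _ cf]; exists (coset (ker A) c); split.
  split; first by exists c.
  apply/seteqP; split=> [_ [_ [z z0 <-] <-]|_ ->].
    by rewrite /= (linearmapD Alin) z0 addr0.
  exists c => //; exists 0; rewrite ?addr0//; exact: linearmap0.
move=> _ [[d ->] dE].
have df : A d = f.
  have : [set f] (A d).
    by rewrite -dE; exists d => //; exists 0; rewrite ?addr0//; exact: linearmap0.
  by [].
apply/seteqP; split=> _ [z z0 <-].
  exists (c + z - d); last by rewrite addrC subrK.
  by rewrite /ker/= (linearmapB Alin) (linearmapD Alin) z0 cf df addr0 subrr.
exists (d + z - c); last by rewrite addrC subrK.
by rewrite /ker/= (linearmapB Alin) (linearmapD Alin) z0 cf df addr0 subrr.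
Qed.

(** Restricting [A] to the orthogonal complement of its kernel keeps the range and turns the
    quotient norm into the norm, so [closed_range] applies. *)
Lemma closed_range_quotient (A : V -> W) (alpha : R) :
  bounded_operator A -> 0 < alpha ->
  (forall x, alpha * quotient_norm (ker A) x <= nrm (A x)) -> closed (range A).
Proof.
move=> Ab a0 low; have Alin := Ab.1.
have Ns := ker_subspace Alin; have Nc := ker_closed Ab.
pose A' (x : quotient (ker A)) := A (qval x).
have A'lin : linear A' by move=> a x y; exact: Alin.
have A'b : bounded_operator A'.
  split=> //; have [C C0 CA] := (opnorm_ltyP Alin).1 Ab.2.
  by apply/opnorm_ltyP => //; exists C => // x; rewrite nrm_quotient; exact: CA.
have -> : range A = range A'.
  apply/seteqP; split=> _ [x _ <-]; last by exists (qval x).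
  exists (Defs.Quotient (orth_projC_perp Ns Nc x)) => //.
  rewrite /A'/= (linearmapB Alin).
  by have := orth_proj_in Ns Nc x; rewrite {1}/ker/= => ->; rewrite subr0.
apply: (@closed_range _ _ _ _ A' alpha^-1) => // x.
rewrite ler_pdivlMl//; apply: le_trans (low (qval x)).
rewrite ler_wpM2l ?(ltW a0)// quotient_normE// nrm_quotient.
rewrite [orth_proj _ _](_ : _ = 0) ?subr0//.
apply: orth_proj_uniq => //; first exact: Ns.1.
by move=> u uN; rewrite subr0; have /asboolP := valP x; exact.
Qed.

End Cosets.

(** * Truncation and padding in the countable Hilbert sum *)

Section HilbertSums.
Context {R : realType} {k : field_kind} {E : nat -> hilbertType R k}.
Local Notation F := (scalar_field R k).
Implicit Types c x y : hsum E.

Definition trunc n c : Efin E n := fun l : 'I_n => hval c l.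
Arguments trunc n c : clear implicits.

Local Notation sqr_series x := (series (fun i => nrm (hval x i) ^+ 2)).

Lemma cvg_sqr_series x : sqr_series x @ \oo --> nrm x ^+ 2.
Proof.
have -> : nrm x ^+ 2 = limn (sqr_series x) by rewrite -sre_inner; exact: sre_hinner.
exact: hsum_summable.
Qed.

Lemma sqr_series_le x n : sqr_series x n <= nrm x ^+ 2.
Proof.
rewrite -(cvg_lim _ (@cvg_sqr_series x))//.
exact: (nondecreasing_cvgn_le (@nondecreasing_series_sqr _ _ _ _) (@hsum_summable _ _ _ x)).
Qed.

Lemma nrm_hsum_le x (B : R) : (forall n, sqr_series x n <= B) -> nrm x ^+ 2 <= B.
Proof.
move=> h; apply: (@cvgr_to_le _ _ _ _ _ _ _ (@cvg_sqr_series x)).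
by apply: nearW.
Qed.

Lemma sqr_nrm_trunc n x : nrm (trunc n x) ^+ 2 = sqr_series x n.
Proof. by rewrite sqr_nrm_fsum /series/= big_mkord. Qed.

Lemma nrm_trunc n x : nrm (trunc n x) <= nrm x.
Proof.
by rewrite -(@ler_pXn2r _ 2)// ?nnegrE ?nrm_ge0// sqr_nrm_trunc sqr_series_le.
Qed.

Lemma trunc_linear n : linear (trunc n).
Proof. by []. Qed.

Lemma pad_family_out m (c : Efin E m) l : (m <= l)%N -> pad_family c l = 0.
Proof.
move=> ml; rewrite /pad_family; case: {-}_ / idP => // lm.
by have := leq_trans lm ml; rewrite ltnn.
Qed.

Lemma pad_linear m : linear (@pad R k E m).
Proof.
move=> a x y; apply: val_inj; apply: functional_extensionality_dep => l.
change (pad_family (a *: x + y) l = a *: pad_family x l + pad_family y l).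
have [lm|ml] := ltnP l m; last by rewrite !pad_family_out// scaler0 addr0.
by have := fun z : Efin E m => pad_familyE z (Ordinal lm) => /= pE; rewrite !pE.
Qed.

(** The family [f] is general because it serves both for squared norms and for the maps [S l]. *)
Lemma sum_pad (T : nmodType) (f : forall l, E l -> T) m (c : Efin E m) n :
  (forall l, f l 0 = 0) -> (m <= n)%N ->
  \sum_(l < n) f l (pad_family c l) = \sum_(l < m) f l (c l).
Proof.
move=> f0 mn; rewrite -(big_mkord xpredT (fun l => f l (pad_family c l))).
rewrite (big_cat_nat (n := m))//= [X in _ + X]big1_seq ?addr0.
  by rewrite big_mkord; apply: eq_bigr => l _; rewrite pad_familyE.
move=> l; rewrite mem_index_iota => /andP[_ /andP[ml _]].
by rewrite pad_family_out.
Qed.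

Lemma nrm_pad m (c : Efin E m) : nrm (pad c) = nrm c.
Proof.
apply/eqP; rewrite -(@eqrXn2 _ 2)// ?nrm_ge0//; apply/eqP.
rewrite -(cvg_lim _ (@cvg_sqr_series (pad c)))// sqr_nrm_fsum.
apply: cvg_lim => //; apply: cvg_near_cst; exists m => // n /= mn.
rewrite /series/= big_mkord.
by rewrite (@sum_pad _ (fun l (z : E l) => nrm z ^+ 2))// => l; rewrite nrm0 expr0n.
Qed.

(** The squared error is a tail of the convergent series of the squared norms of the coordinates. *)
Lemma cvg_pad_trunc c : (fun n => pad (trunc n c)) @ \oo --> c.
Proof.
apply/cvg_nrmP/cvgrPdist_lt => e e0.
have /cvgrPdist_lt/(_ (e ^+ 2)) := @cvg_sqr_series c.
move=> []; first by rewrite exprn_gt0.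
move=> N _ NP; exists N => // n /NP /=.
rewrite ger0_norm ?subr_ge0 ?sqr_series_le// sub0r normrN ger0_norm ?nrm_ge0// => h.
rewrite -(@ltr_pXn2r _ 2)// ?nnegrE ?nrm_ge0 ?(ltW e0)//; apply: le_lt_trans h.
(* Up to [Q], which is at least [n] and [P], the error has zero coordinates below [n] and those of
   [c], up to sign, from [n] on. *)
apply: nrm_hsum_le => P; pose Q := maxn n P.
pose g i := nrm (hval (pad (trunc n c) - c) i) ^+ 2.
apply: (@le_trans _ _ (series g Q)).
  apply: (nondecreasing_series (P := xpredT)); last exact: leq_maxr.
  by move=> i _ _; rewrite exprn_ge0// nrm_ge0.
rewrite lerBrDr; apply: le_trans (sqr_series_le c Q).
have nQ : (n <= Q)%N := leq_maxl n P.
have split_at (f : nat -> R) :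
    \sum_(0 <= i < Q) f i = \sum_(0 <= i < n) f i + \sum_(n <= i < Q) f i.
  exact: big_cat_nat.
rewrite /series/= (split_at g) [in leRHS]split_at [leRHS]addrC lerD2r big1_seq ?add0r.
  apply: ler_sum_nat => i /andP[ni _].
  rewrite /g -[hval _ i]/(pad_family (trunc n c) i - hval c i).
  by rewrite pad_family_out// sub0r nrmN.
move=> i; rewrite mem_index_iota => /andP[_ /andP[_ ilt]].
rewrite /g -[hval _ i]/(pad_family (trunc n c) i - hval c i).
by rewrite (pad_familyE (trunc n c) (Ordinal ilt)) subrr nrm0 expr0n.
Qed.

End HilbertSums.
Arguments trunc {R k E} n c.

(** * The synthesis operator on the countable sum *)

Section Synthesis.
Context {R : realType} {k : field_kind} {H : hilbertType R k}.
Context {E : nat -> hilbertType R k} {S : forall l, E l -> H}.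
Arguments S : clear implicits.
Hypothesis S_bounded : forall l, bounded_operator (S l).
Variable B : R.
Hypothesis B_ge0 : 0 <= B.
Hypothesis Sfin_le : forall m, (0 < m)%N -> forall c, nrm (Sfin S m c) <= B * nrm c.

Definition synthesis (c : hsum E) : H := limn (fun n => Sfin S n (trunc n c)).

Lemma Sfin_trunc_pad m (c : Efin E m) n :
  (m <= n)%N -> Sfin S n (trunc n (pad c)) = Sfin S m c.
Proof. by apply: sum_pad => l; exact: linearmap0 (S_bounded l).1. Qed.

Lemma Sfin_trunc_le n c : nrm (Sfin S n (trunc n c)) <= B * nrm c.
Proof.
case: n => [|n]; first by rewrite /Sfin big_ord0 nrm0 mulr_ge0// nrm_ge0.
by apply: le_trans (Sfin_le _ _) _; rewrite // ler_wpM2l// nrm_trunc.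
Qed.

Lemma cvg_synthesis c : (fun n => Sfin S n (trunc n c)) @ \oo --> synthesis c.
Proof.
(* The difference is the partial synthesis of the tail [c - pad (trunc m c)], so the uniform bound
   [B] applies to it. *)
have key m n : (m <= n)%N ->
    nrm (Sfin S n (trunc n c) - Sfin S m (trunc m c)) <= B * nrm (pad (trunc m c) - c).
  move=> mn; rewrite -(@Sfin_trunc_pad m (trunc m c) n mn).
  rewrite -(linearmapB (Sfin_linear S_bounded (m := n))).
  by rewrite nrmBC; exact: (@Sfin_trunc_le n (c - pad (trunc m c))).
apply: nrm_cauchy_cvg => e e0.
have B1 : 0 < B + 1 by rewrite ltr_wpDl.
have /cvg_nrmP/cvgrPdist_lt/(_ (e / 2 / (B + 1))) := @cvg_pad_trunc _ _ _ c.
move=> []; first by rewrite !divr_gt0.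
move=> N _ /(_ N) /=; rewrite leqnn sub0r normrN ger0_norm ?nrm_ge0// => /(_ isT).
rewrite ltr_pdivlMr// => h.
have {}key n : (N <= n)%N -> nrm (Sfin S n (trunc n c) - Sfin S N (trunc N c)) < e / 2.
  by move=> /key /le_lt_trans; apply; have := nrm_ge0 (pad (trunc N c) - c); lra.
exists N => m n /key hm /key hn.
rewrite -(subrKA (Sfin S N (trunc N c))); apply: le_lt_trans (nrmD _ _) _.
by rewrite (nrmBC (Sfin S N _)); lra.
Qed.

Lemma synthesis_linear : linear synthesis.
Proof.
move=> a x y; apply: cvg_lim => //.
under eq_fun do rewrite trunc_linear (Sfin_linear S_bounded (m := _)).
by apply: cvgD; [apply: cvgZr|]; exact: cvg_synthesis.
Qed.

Lemma synthesis_bounded : bounded_operator synthesis.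
Proof.
split; first exact: synthesis_linear.
apply/opnorm_ltyP; first exact: synthesis_linear.
exists B => // c; apply: (@cvgr_to_le _ _ _ _ _ _ _ (cvg_nrm (@cvg_synthesis c))).
by apply: nearW => n; exact: Sfin_trunc_le.
Qed.

Lemma synthesis_pad m (c : Efin E m) : synthesis (pad c) = Sfin S m c.
Proof.
apply: cvg_lim => //; apply: cvg_near_cst; exists m => // n /= mn.
exact: Sfin_trunc_pad.
Qed.

(** Padded finite coefficients are dense and both operators are continuous. *)
Lemma synthesis_unique (S' : hsum E -> H) : bounded_operator S' ->
  (forall m, (0 < m)%N -> forall c : Efin E m, S' (pad c) = Sfin S m c) ->
  S' = synthesis.
Proof.
move=> S'b S'pad; apply/funext => c.
(* The shift to [n.+1] keeps to the levels m >= 1, where [S'] is prescribed. *)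
have cv : (fun n => pad (trunc n.+1 c)) @ \oo --> c.
  by have := @cvg_pad_trunc _ _ _ c; rewrite -cvg_shiftS.
rewrite -(cvg_lim _ (bounded_operator_cvg S'b cv))//; apply: cvg_lim => //.
have -> : S' \o (fun n => pad (trunc n.+1 c)) = synthesis \o (fun n => pad (trunc n.+1 c)).
  by apply/funext => n /=; rewrite S'pad// synthesis_pad.
by have := bounded_operator_cvg synthesis_bounded cv; apply.
Qed.

(** Padding sends ker S^(m) into the kernel of [synthesis], so the quotient norm can only drop in
    passing from level m to the countable sum. The projection [Q] off that kernel is continuous, and
    the inequality passes to the limit along the truncations. *)
Lemma synthesis_lower (alpha : R) : 0 <= alpha ->
  (forall m, (0 < m)%N -> forall c,
     alpha * quotient_norm (ker (Sfin S m)) c <= nrm (Sfin S m c)) ->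
  forall c, alpha * quotient_norm (ker synthesis) c <= nrm (synthesis c).
Proof.
move=> a0 low c.
have Ns := ker_subspace synthesis_linear; have Nc := ker_closed synthesis_bounded.
pose Q x := x - orth_proj (ker synthesis) x.
have Qlin : linear Q.
  by move=> a x y; rewrite /Q orth_proj_linear// opprD addrACA -scalerBr.
have Qb : bounded_operator Q.
  split=> //; apply/opnorm_ltyP => //; exists 1 => // x.
  by rewrite mul1r; exact: nrm_orth_projC.
have Qpad m (d : Efin E m) : nrm (Q (pad d)) <= quotient_norm (ker (Sfin S m)) d.
  have Ns' := ker_subspace (@Sfin_linear _ _ _ _ _ S_bounded m).
  have Nc' := ker_closed (@Sfin_bounded _ _ _ _ _ S_bounded m).
  rewrite quotient_normE// -nrm_pad (linearmapB (@pad_linear _ _ _ m)).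
  apply: nrm_orth_projC_le => //; rewrite /ker/= (linearmapN synthesis_linear).
  rewrite synthesis_pad; have := orth_proj_in Ns' Nc' d.
  by rewrite {1}/ker/= => ->; rewrite oppr0.
rewrite quotient_normE// -/(Q c).
have cv : (fun n => pad (trunc n.+1 c)) @ \oo --> c.
  by have := @cvg_pad_trunc _ _ _ c; rewrite -cvg_shiftS.
have cQ := cvg_nrm (bounded_operator_cvg Qb cv).
have cS := cvg_nrm (bounded_operator_cvg synthesis_bounded cv).
have cQ' : (fun n => alpha * nrm (Q (pad (trunc n.+1 c)))) @ \oo --> alpha * nrm (Q c).
  exact: cvgMr cQ.
apply: (ler_cvg_to cQ' cS); apply: nearW => n /=.
rewrite synthesis_pad; apply: le_trans (low _ _ _) => //.
by rewrite ler_wpM2l.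
Qed.

End Synthesis.
Arguments synthesis {R k H E} S c.

Theorem theorem2p2 (R : realType) (k : field_kind)
  (H : hilbertType R k) (E : nat -> hilbertType R k)
  (S : forall l : nat, E l -> H)
  (delta Delta M K : R)
  (S_bounded : forall l : nat, bounded_operator (S l))
  (V_closed : forall m : nat, (0 < m)%N -> closed (Vspace S m))
  (delta_gt0 : 0 < delta) (delta_le_Delta : delta <= Delta)
  (D_lower : forall l : nat,
     loewner_le (fun x : Equot S l => sreal delta *: x) (Dhat S l))
  (D_upper : forall l : nat,
     loewner_le (Dhat S l) (fun x : Equot S l => sreal Delta *: x))
  (L_bound : forall m : nat, (0 < m)%N ->
     (opnorm (Lop S m) <= M%:E)%E)
  (Linv_bound : forall m : nat, (0 < m)%N ->
     (opnorm (inverse (Lop S m)) <= K%:E)%E) :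
  (forall m : nat, (0 < m)%N -> forall c : Efin E m,
     delta / K ^+ 2 * quotient_norm (ker (Sfin S m)) c ^+ 2
       <= nrm (Sfin S m c) ^+ 2
     /\
     nrm (Sfin S m c) ^+ 2
       <= Delta * M ^+ 2 * quotient_norm (ker (Sfin S m)) c ^+ 2)
  /\
  (exists Sinf : hsum E -> H,
     [/\ (* Sinf is the unique bounded operator extending every S^(m) *)
         [/\ bounded_operator Sinf,
             forall m : nat, (0 < m)%N ->
               forall c : Efin E m, Sinf (pad c) = Sfin S m c
           & forall S' : hsum E -> H, bounded_operator S' ->
               (forall m : nat, (0 < m)%N ->
                  forall c : Efin E m, S' (pad c) = Sfin S m c) ->
               S' = Sinf],
         (* the induced map is bounded below *)
         forall c : hsum E,
           Num.sqrt delta / K * quotient_norm (ker Sinf) c <= nrm (Sinf c),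
         (* its image is closed *)
         closed (range Sinf)
       & (* unique class, unique minimum-norm representative *)
         forall f : H, range Sinf f ->
           (exists! A : set (hsum E),
              is_coset (ker Sinf) A /\ Sinf @` A = [set f])
           /\
           (forall A : set (hsum E),
              is_coset (ker Sinf) A -> Sinf @` A = [set f] ->
              exists! c : hsum E,
                A c /\ forall c' : hsum E, A c' -> nrm c <= nrm c')]).
Proof.
have Delta_ge0 : 0 <= Delta := ltW (lt_le_trans delta_gt0 delta_le_Delta).
(* The sign of [M] is read off from the bound at m = 1. *)
have M_ge0 : 0 <= M := opnorm_bound_ge0 (@L_bound 1%N isT).
have lower m (m0 : (0 < m)%N) (B : R) :=
  @Sfin_lower _ _ _ _ _ S_bounded V_closed _ delta_gt0 D_lower M B m (L_bound m m0).
have Sfin_le m (m0 : (0 < m)%N) c :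
    nrm (Sfin S m c) ^+ 2 <= Delta * M ^+ 2 * quotient_norm (ker (Sfin S m)) c ^+ 2.
  apply: (@Sfin_upper _ _ _ _ _ S_bounded V_closed delta) => //.
  exact: L_bound.
split=> [m m0 c|]; first by split; [exact: lower m m0 K (Linv_bound m m0) c|exact: Sfin_le].
pose B : R := Num.sqrt Delta * M.
have B_ge0 : 0 <= B by rewrite mulr_ge0// sqrtr_ge0.
(* Since the quotient norm is at most the norm, the upper estimate bounds all [Sfin S m] by the same
   constant. *)
have SB m : (0 < m)%N -> forall c, nrm (Sfin S m c) <= B * nrm c.
  move=> m0 c; rewrite -(@ler_pXn2r _ 2)// ?nnegrE ?nrm_ge0 ?mulr_ge0 ?nrm_ge0//.
  apply: le_trans (Sfin_le m m0 c) _; rewrite !exprMn sqr_sqrtr//.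
  have Ns := ker_Sfin_subspace S_bounded m.
  have Nc := @ker_Sfin_closed _ _ _ _ _ S_bounded m.
  rewrite ler_wpM2l ?mulr_ge0 ?exprn_ge0// quotient_normE//.
  by rewrite ler_pXn2r ?nnegrE ?nrm_ge0// nrm_orth_projC.
have Sb := synthesis_bounded S_bounded B_ge0 SB.
(* The constant is left free: it is [K] in the stated lower bound, and a positive majorant of [K] in
   the proof that the range is closed. *)
have low (K' : R) : 0 <= K' ->
    (forall m, (0 < m)%N -> (opnorm (inverse (Lop S m)) <= K'%:E)%E) ->
    forall c, Num.sqrt delta / K' * quotient_norm (ker (synthesis S)) c <=
      nrm (synthesis S c).
  move=> K0 LK; apply: (@synthesis_lower _ _ _ _ _ S_bounded B B_ge0 SB).
    by rewrite divr_ge0// sqrtr_ge0.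
  move=> m m0 c; have [x _ xE] := Shat_class S_bounded c.
  rewrite -(@ler_pXn2r _ 2)// ?nnegrE -?xE
    ?(nrm_ge0, mulr_ge0, divr_ge0, invr_ge0, sqrtr_ge0)//.
  rewrite xE !exprMn exprVn sqr_sqrtr ?(ltW delta_gt0)//.
  exact: (lower m m0 _ (LK m m0) c).
exists (synthesis S); split.
- split=> //; first by move=> m m0 c; exact: synthesis_pad.
  by move=> S' S'b S'pad; exact: (synthesis_unique S_bounded B_ge0 SB).
- by apply: low => //; exact: opnorm_bound_ge0 (@Linv_bound 1%N isT).
- (* For K = 0 the quotient sqrt delta / K is the junk value 0. *)
  have K1 : 0 < Num.max K 1 by rewrite lt_max ltr01 orbT.
  apply: (closed_range_quotient (alpha := Num.sqrt delta / Num.max K 1)) => //.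
    by rewrite divr_gt0// sqrtr_gt0.
  apply: low; first exact: ltW.
  by move=> m m0; apply: le_trans (Linv_bound m m0) _; rewrite lee_fin le_max lexx.
- move=> f fS; split; first exact: unique_coset Sb.1 fS.
  move=> A Acos _; apply: min_norm_coset Acos; first exact: ker_subspace Sb.1.
  exact: ker_closed.
Qed.
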